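(* Let $Y$ be a Banach space and $1<p<\infty$. If $\mathcal{K}(\ell_p,Y)$ is an M-ideal in $\mathcal{L}(\ell_p,Y)$, then $(\ell_p,Y)$ has the weak maximizing property (WMP).
   Context: The scalar field is $\mathbb{R}$ or $\mathbb{C}$; $\mathcal{L}(X,Y)$ is the Banach space of bounded linear operators and $\mathcal{K}(X,Y)$ the subspace of compact operators; $B_X$, $S_X$ are the closed unit ball and unit sphere. A closed subspace $J$ of a Banach space $E$ is an L-summand if there is a linear projection $P$ on $E$ with $PE=J$ and $\|x\|=\|Px\|+\|x-Px\|$ for all $x\in E$; $J$ is an M-ideal in $E$ if its annihilator $J^\perp$ is an L-summand in $E^*$. An operator $T\in\mathcal{L}(X,Y)$ attains its norm if $\|Tx\|=\|T\|$ for some $x\in S_X$. A maximizing sequence of $T$ is a sequence $(x_n)\subset B_X$ with $\lim_n\|Tx_n\|=\|T\|$. The pair $(X,Y)$ has the WMP if every $T\in\mathcal{L}(X,Y)$ having a maximizing sequence that is not weakly null attains its norm. *)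

(* Defs.v *)
From HB Require Import structures.
From mathcomp Require Import all_boot all_order all_algebra.
From mathcomp Require Import complex.
From mathcomp Require Import all_classical all_reals all_analysis.
Set Implicit Arguments.
Unset Strict Implicit.
Unset Printing Implicit Defensive.
Import Order.TTheory GRing.Theory Num.Theory.
Import numFieldNormedType.Exports.
Local Open Scope classical_set_scope.
Local Open Scope ring_scope.

Variant scalar_kind := RealScalars | ComplexScalars.

(* The norm of a [normedModType K] is K-valued, so over R[i] every norm below is
   a nonnegative real seen in R[i], and [<=] is the partial order of R[i].
   [scalar_re] and [scalar_of] go back and forth between these and R. *)
Definition scalars (R : realType) (k : scalar_kind) : numFieldType :=
  match k with RealScalars => R | ComplexScalars => R[i] end.

Definition scalar_re (R : realType) (k : scalar_kind) : scalars R k -> R :=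
  match k with RealScalars => id | ComplexScalars => @complex.Re R end.

Definition scalar_of (R : realType) (k : scalar_kind) : R -> scalars R k :=
  match k with RealScalars => id | ComplexScalars => fun x => (x%:C)%C end.

Section ScalarTheory.
Context (R : realType) (k : scalar_kind).
Local Notation K := (scalars R k).
Local Notation re := (@scalar_re R k).
Local Notation of_ := (@scalar_of R k).

Lemma scalar_ofK (x : R) : re (of_ x) = x.
Proof. by case: k. Qed.

Lemma scalar_reK (a : K) : 0 <= a -> of_ (re a) = a.
Proof.
case: k a => //= -[a b].
by rewrite lecE /= => /andP[/eqP -> _].
Qed.

Lemma scalar_ofD (x y : R) : of_ (x + y) = of_ x + of_ y.
Proof. by case: k => //=; rewrite rmorphD. Qed.

Lemma scalar_ofM (x y : R) : of_ (x * y) = of_ x * of_ y.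
Proof. by case: k => //=; rewrite rmorphM. Qed.

Lemma scalar_of0 : of_ 0 = 0.
Proof. by case: k. Qed.

Lemma scalar_of1 : of_ 1 = 1.
Proof. by case: k. Qed.

Lemma scalar_of_le (x y : R) : (of_ x <= of_ y) = (x <= y).
Proof. by case: k => //=; rewrite lecR. Qed.
End ScalarTheory.
Arguments scalar_ofK {R} k x.
Arguments scalar_of0 {R} k.
Arguments scalar_of1 {R} k.
Arguments scalar_of_le {R} k x y.

Section RealNorm.
Context (R : realType) (k : scalar_kind).
Local Notation K := (scalars R k).

Definition normr_re (V : normedModType K) (x : V) : R := scalar_re `|x|.

Lemma normr_reE (V : normedModType K) (x : V) :
  `|x| = scalar_of k (normr_re x).
Proof. by rewrite scalar_reK. Qed.

Lemma normr_re_ge0 (V : normedModType K) (x : V) : 0 <= normr_re x.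
Proof. by rewrite -(scalar_of_le k) -normr_reE scalar_of0. Qed.

Lemma normr_reD (V : normedModType K) (x y : V) :
  normr_re (x + y) <= normr_re x + normr_re y.
Proof. by rewrite -(scalar_of_le k) scalar_ofD -!normr_reE ler_normD. Qed.

Lemma normr_reZ (V : normedModType K) (a : K) (x : V) :
  normr_re (a *: x) = normr_re (a : K^o) * normr_re x.
Proof.
apply: (can_inj (scalar_ofK k)).
by rewrite scalar_ofM -!normr_reE normrZ.
Qed.

Lemma normr_re0 (V : normedModType K) : normr_re (0 : V) = 0.
Proof. by rewrite /normr_re normr0 -(scalar_of0 k) scalar_ofK. Qed.

Lemma normr_re_eq0 (V : normedModType K) (x : V) : normr_re x = 0 -> x = 0.
Proof. by move=> x0; apply/normr0_eq0; rewrite normr_reE x0 scalar_of0. Qed.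

End RealNorm.

Section BoundedOperators.
Context (R : realType) (k : scalar_kind).
Local Notation K := (scalars R k).
Context (X Y : normedModType K).

Definition bounded_op_pred : {pred X -> Y} :=
  fun f => `[< linear f /\ continuous f >].

Record bounded_op := BoundedOp {
  bounded_op_fun :> X -> Y;
  bounded_op_funP : bounded_op_fun \in bounded_op_pred }.

HB.instance Definition _ := [isSub for bounded_op_fun].
HB.instance Definition _ := [Choice of bounded_op by <:].

Lemma bounded_op_submod_closed : submod_closed bounded_op_pred.
Proof.
split.
  apply/asboolP; split; last exact: cst_continuous.
  by move=> a x y /=; rewrite scaler0 addr0.
move=> a f g /asboolP[lf cf] /asboolP[lg cg]; apply/asboolP; split.
  move=> b x y; rewrite !fctE lf lg !scalerDr !scalerA (mulrC a).
  by rewrite addrACA.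
move=> x; apply: cvgD; last exact: cg.
by apply: cvgZr; exact: cf.
Qed.

HB.instance Definition _ :=
  GRing.isSubmodClosed.Build _ _ bounded_op_pred
    bounded_op_submod_closed.
HB.instance Definition _ :=
  [SubChoice_isSubLmodule of bounded_op by <:].

Lemma bounded_op_linear (T : bounded_op) : linear T.
Proof. by have /asboolP[] := bounded_op_funP T. Qed.

HB.instance Definition _ (T : bounded_op) :=
  GRing.isLinear.Build K X Y *:%R T (bounded_op_linear T).

Lemma bounded_op_continuous (T : bounded_op) : continuous T.
Proof. by have /asboolP[] := bounded_op_funP T. Qed.
Arguments bounded_op_continuous : clear implicits.

Definition opnorm_set (T : bounded_op) : set R :=
  [set normr_re (T x) | x in [set x : X | `|x| <= 1]].

Definition opnorm (T : bounded_op) : K := scalar_of k (sup (opnorm_set T)).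

Lemma opnorm_set_has_sup (T : bounded_op) : has_sup (opnorm_set T).
Proof.
split; first by exists (normr_re (T 0)), 0; rewrite //= normr0.
have /linear_bounded_continuous/linear_boundedP := bounded_op_continuous T.
move=> /pinfty_ex_gt0[M M0 TM]; exists (scalar_re M) => _ [x /= x1 <-].
rewrite -(scalar_of_le k) -normr_reE scalar_reK ?(ltW M0)//.
by rewrite (le_trans (TM x))// ler_piMr// ltW.
Qed.

Lemma normr_re_le_sup (T : bounded_op) (x : X) :
  normr_re (T x) <= sup (opnorm_set T) * normr_re x.
Proof.
have [->|x0] := eqVneq x 0; first by rewrite linear0 !normr_re0 mulr0.
have nx0 : `|x| != 0 by rewrite normr_eq0.
have rx0 : 0 < normr_re x.
  rewrite lt_neqAle normr_re_ge0 andbT eq_sym.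
  by apply: contra x0 => /eqP/normr_re_eq0 ->.
rewrite -ler_pdivrMr// mulrC.
have -> : (normr_re x)^-1 * normr_re (T x) = normr_re (T (`|x|^-1 *: x)).
  rewrite linearZ normr_reZ; congr (_ * _).
  apply: (mulIf (lt0r_neq0 rx0)); rewrite mulVf ?lt0r_neq0//.
  rewrite -normr_reZ; apply: (can_inj (scalar_ofK k)).
  by rewrite -normr_reE normrZ normrV ?unitfE// normr_id mulVf// scalar_of1.
apply: sup_ubound; first by have [] := opnorm_set_has_sup T.
exists (`|x|^-1 *: x) => //=.
by rewrite normrZ normrV ?unitfE// normr_id mulVf.
Qed.

Lemma sup_opnorm_set_ge0 (T : bounded_op) : 0 <= sup (opnorm_set T).
Proof.
apply: (le_trans (normr_re_ge0 (T 0))).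
apply: sup_ubound; first by have [] := opnorm_set_has_sup T.
by exists 0; rewrite //= normr0.
Qed.

Lemma sup_opnorm_set_le (T : bounded_op) (M : R) : 0 <= M ->
  (forall x, normr_re (T x) <= M * normr_re x) -> sup (opnorm_set T) <= M.
Proof.
move=> M0 TM; apply: ge_sup; first by have [] := opnorm_set_has_sup T.
move=> _ [x /= x1 <-]; rewrite (le_trans (TM x))// ler_piMr//.
by rewrite -(scalar_of_le k) -normr_reE scalar_of1.
Qed.

Lemma opnormD (S T : bounded_op) : opnorm (S + T) <= opnorm S + opnorm T.
Proof.
rewrite /opnorm -scalar_ofD scalar_of_le; apply: sup_opnorm_set_le.
  by rewrite addr_ge0 ?sup_opnorm_set_ge0.
move=> x; rewrite (le_trans (normr_reD (S x) (T x)))// mulrDl.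
by rewrite lerD ?normr_re_le_sup.
Qed.

Lemma opnormZ (a : K) (T : bounded_op) :
  opnorm (a *: T) = `|a| * opnorm T.
Proof.
rewrite /opnorm.
have H (b : K) (S : bounded_op) :
    sup (opnorm_set (b *: S)) <= normr_re (b : K^o) * sup (opnorm_set S).
  apply: sup_opnorm_set_le => [|x].
    by rewrite mulr_ge0 ?normr_re_ge0 ?sup_opnorm_set_ge0.
  rewrite -[(b *: S) x]/(b *: S x) normr_reZ -mulrA.
  by rewrite ler_wpM2l ?normr_re_ge0 ?normr_re_le_sup.
rewrite [X in X * _](normr_reE (a : K^o)) -scalar_ofM; congr (scalar_of k _).
apply/eqP; rewrite eq_le H/=.
have [->|a0] := eqVneq a 0.
  by rewrite (normr_re0 K^o) mul0r sup_opnorm_set_ge0.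
have ra0 : 0 < normr_re (a : K^o).
  rewrite lt_neqAle normr_re_ge0 andbT eq_sym.
  by apply: contra a0 => /eqP/(@normr_re_eq0 _ _ K^o) ->.
rewrite mulrC -ler_pdivlMr// mulrC.
have := H a^-1 (a *: T); rewrite scalerA mulVf// scale1r.
congr (_ <= _ * _).
apply: (mulIf (lt0r_neq0 ra0)); rewrite mulVf ?lt0r_neq0//.
rewrite -(normr_reZ a^-1 (a : K^o)) /GRing.scale/= mulVf//.
by apply: (can_inj (scalar_ofK k)); rewrite -normr_reE normr1 scalar_of1.
Qed.

Lemma opnorm_eq0 (T : bounded_op) : opnorm T = 0 -> T = 0.
Proof.
move=> T0; apply/val_inj/funext => x /=; apply: normr_re_eq0.
apply/eqP; rewrite eq_le normr_re_ge0 andbT.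
rewrite (le_trans (normr_re_le_sup T x))//.
by rewrite -(scalar_ofK k (sup _)) -/(opnorm T) T0 -(scalar_of0 k) scalar_ofK mul0r.
Qed.

HB.instance Definition _ :=
  @Lmodule_isNormed.Build K bounded_op opnorm opnormD opnormZ opnorm_eq0.

End BoundedOperators.

Section EllP.
Context (R : realType) (k : scalar_kind).
Local Notation K := (scalars R k).

Definition pth_power_sum (p : R) (x : nat -> K) : \bar R :=
  (\sum_(0 <= n <oo) (normr_re (x n : K^o) `^ p)%:E)%E.

Definition ellp_pred (p : R) : {pred nat -> K} :=
  fun x => (pth_power_sum p x < +oo)%E.

(* The parameter [p1] is what makes the l_p norm below an instance on this type. *)
Record ellp (p : R) (p1 : 1 <= p) := Ellp {
  ellp_fun :> nat -> K;
  ellp_funP : ellp_fun \in ellp_pred p }.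

HB.instance Definition _ (p : R) (p1 : 1 <= p) := [isSub for @ellp_fun p p1].
HB.instance Definition _ (p : R) (p1 : 1 <= p) :=
  [Choice of ellp p1 by <:].

Context (p : R) (p1 : 1 <= p).
Local Notation lp := (ellp p1).

Let p0 : 0 < p. Proof. exact: lt_le_trans p1. Qed.

Lemma pth_power_sum_ge0 (x : nat -> K) : (0 <= pth_power_sum p x)%E.
Proof. by apply: nneseries_ge0 => n _ _; rewrite lee_fin powR_ge0. Qed.

Lemma pth_power_sum_Lnorm (x : nat -> K) :
  (pth_power_sum p x `^ p^-1)%E =
  Lnorm (@counting nat R) p%:E (EFin \o (fun n => normr_re (x n : K^o))).
Proof.
rewrite Lnorm_counting//; congr (_ `^ _)%E.
apply: eq_eseriesr => n _ /=.
by rewrite ger0_norm// normr_re_ge0.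
Qed.

Lemma minkowski_ellp (x y : nat -> K) :
  (pth_power_sum p (x + y)%R `^ p^-1 <=
   pth_power_sum p x `^ p^-1 + pth_power_sum p y `^ p^-1)%E.
Proof.
rewrite !pth_power_sum_Lnorm.
apply: le_trans (minkowski_EFin _ _ _ p1) => //.
rewrite !Lnorm_counting//; apply: gt0_ler_poweR.
- by rewrite invr_ge0 ltW.
- rewrite in_itv/= leey andbT.
  by apply: nneseries_ge0 => n _ _; rewrite lee_fin powR_ge0.
- rewrite in_itv/= leey andbT.
  by apply: nneseries_ge0 => n _ _; rewrite lee_fin powR_ge0.
apply: lee_nneseries => n _; first by rewrite lee_fin powR_ge0.
rewrite /= lee_fin !ger0_norm ?addr_ge0 ?normr_re_ge0//.
by rewrite ge0_ler_powR ?nnegrE ?addr_ge0 ?normr_re_ge0 ?(ltW p0) ?normr_reD.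
Qed.

Lemma pth_power_sumZ (a : K) (x : nat -> K) : pth_power_sum p (a *: x) =
  ((normr_re (a : K^o) `^ p)%:E * pth_power_sum p x)%E.
Proof.
rewrite /pth_power_sum -nneseriesZl; last first.
  by move=> n _; rewrite lee_fin powR_ge0.
apply: eq_eseriesr => n _ /=.
by rewrite (normr_reZ a (x n : K^o)) powRM ?normr_re_ge0// EFinM.
Qed.

Lemma ellp_submod_closed : submod_closed (ellp_pred p).
Proof.
split.
  rewrite unfold_in /ellp_pred /pth_power_sum eseries0// => n _ _.
  by rewrite (normr_re0 K^o) powR0// gt_eqF.
move=> a x y; rewrite !unfold_in /ellp_pred => xoo yoo.
have ip : (p^-1 != 0)%R by rewrite invr_eq0 gt_eqF.
have ax : (pth_power_sum p (a *: x) < +oo)%E.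
  by rewrite pth_power_sumZ lte_mul_pinfty// lee_fin powR_ge0.
rewrite -/(pth_power_sum p _); apply: (lty_poweRy ip).
apply: (le_lt_trans (minkowski_ellp _ _)).
by rewrite lte_add_pinfty// poweR_lty.
Qed.

HB.instance Definition _ :=
  GRing.isSubmodClosed.Build _ _ (ellp_pred p) ellp_submod_closed.
HB.instance Definition _ := [SubChoice_isSubLmodule of lp by <:].

Definition ellp_norm (x : lp) : K :=
  scalar_of k (fine (pth_power_sum p x) `^ p^-1).

Lemma pth_power_sum_fin (x : lp) : pth_power_sum p x \is a fin_num.
Proof. by rewrite ge0_fin_numE ?pth_power_sum_ge0//; exact: ellp_funP x. Qed.

Lemma ellp_normD (x y : lp) : ellp_norm (x + y) <= ellp_norm x + ellp_norm y.
Proof.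
rewrite /ellp_norm -scalar_ofD scalar_of_le.
have := minkowski_ellp x y.
rewrite -[X in (X `^ _ <= _)%E]/(pth_power_sum p (x + y : lp)).
rewrite -(fineK (pth_power_sum_fin (x + y))) -(fineK (pth_power_sum_fin x)).
by rewrite -(fineK (pth_power_sum_fin y)) !poweR_EFin -EFinD lee_fin.
Qed.

Lemma ellp_normZ (a : K) (x : lp) : ellp_norm (a *: x) = `|a| * ellp_norm x.
Proof.
rewrite /ellp_norm [X in X * _](normr_reE (a : K^o)) -scalar_ofM.
congr (scalar_of k _).
have -> : pth_power_sum p (a *: x) = pth_power_sum p (a *: (x : nat -> K)).
  by [].
rewrite pth_power_sumZ fineM//; last exact: pth_power_sum_fin.
rewrite [fine _%:E]/=.
rewrite powRM ?powR_ge0//; last by rewrite fine_ge0// pth_power_sum_ge0.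
by rewrite -powRrM mulfV ?gt_eqF// powRr1// normr_re_ge0.
Qed.

Lemma ellp_norm_eq0 (x : lp) : ellp_norm x = 0 -> x = 0.
Proof.
move=> x0; apply/val_inj/funext => n /=.
apply: (@normr_re_eq0 R k K^o).
have : fine (pth_power_sum p x) `^ p^-1 = 0.
  by apply: (can_inj (scalar_ofK k)); rewrite scalar_of0.
move=> /eqP; rewrite powR_eq0 => /andP[/eqP s0 _].
have {}s0 : pth_power_sum p x = 0%E by rewrite -(fineK (pth_power_sum_fin x)) s0.
have : ((normr_re (x n : K^o) `^ p)%:E <= 0)%E.
  rewrite -s0 /pth_power_sum (nneseriesD1 (n := n))//; last first.
    by move=> m _; rewrite lee_fin powR_ge0.
  by rewrite leeDl// nneseries_ge0// => m _ _; rewrite lee_fin powR_ge0.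
rewrite lee_fin => xn0; apply: (@powR_eq0_eq0 _ _ p).
by apply/eqP; rewrite eq_le xn0 powR_ge0.
Qed.

HB.instance Definition _ :=
  @Lmodule_isNormed.Build K lp ellp_norm ellp_normD ellp_normZ ellp_norm_eq0.

End EllP.

Section OperatorIdeals.
Context (R : realType) (k : scalar_kind).
Local Notation K := (scalars R k).

Definition dual_space (E : normedModType K) : normedModType K :=
  bounded_op E K^o.

Definition closed_subspace (E : normedModType K) (J : set E) :=
  [/\ J 0, forall (a : K) (x y : E), J x -> J y -> J (a *: x + y) & closed J].

Definition L_summand (E : normedModType K) (J : set E) :=
  closed_subspace J /\
  exists P : {linear E -> E}, [/\ forall x, P (P x) = P x,
    range P = J & forall x, `|x| = `|P x| + `|x - P x|].

Definition annihilator (E : normedModType K) (J : set E) : set (dual_space E) :=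
  [set f | forall x, J x -> f x = 0].

Definition M_ideal (E : normedModType K) (J : set E) :=
  closed_subspace J /\ L_summand (annihilator J).

Definition compact_op (X Y : normedModType K) : set (bounded_op X Y) :=
  [set T | compact (closure (T @` [set x : X | `|x| <= 1]))].

Definition attains_norm (X Y : normedModType K) (T : bounded_op X Y) :=
  exists2 x : X, `|x| = 1 & `|T x| = `|T|.

Definition maximizing_sequence (X Y : normedModType K) (T : bounded_op X Y)
    (u : nat -> X) :=
  (forall n, `|u n| <= 1) /\ (`|T (u n)| : K^o) @[n --> \oo] --> (`|T| : K^o).

Definition weakly_null (X : normedModType K) (u : nat -> X) :=
  forall f : dual_space X, f (u n) @[n --> \oo] --> (0 : K^o).

Definition WMP (X Y : normedModType K) :=
  forall T : bounded_op X Y,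
    (exists2 u, maximizing_sequence T u & ~ weakly_null u) -> attains_norm T.

Lemma bounded_op_le (X Y : normedModType K) (T : bounded_op X Y) (x : X) :
  `|T x| <= `|T| * `|x|.
Proof.
have -> : `|T| = opnorm T by [].
rewrite (normr_reE (T x)) (normr_reE x) /opnorm -scalar_ofM scalar_of_le.
exact: normr_re_le_sup.
Qed.

(* Hence the first conjunct of [M_ideal (compact_op X Y)] is no restriction. *)
Lemma compact_op_closed_subspace (X : normedModType K)
  (Y : completeNormedModType K) : closed_subspace (@compact_op X Y).
Proof.
have cptP (T : bounded_op X Y) (C : set Y) : compact C ->
    T @` [set x | `|x| <= 1] `<=` C -> compact_op T.
  move=> cC TC; rewrite /compact_op/= -precompactE.
  apply: precompact_subset TC _; rewrite precompactE.
  by rewrite -(closure_id C).1//; apply: compact_closed => //; exact: norm_hausdorff.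
split.
- apply: (cptP _ [set 0]); first exact: compact_set1.
  by move=> _ [x _ <-].
- move=> a S T cS cT.
  apply: (cptP _ ((fun y : Y * Y => a *: y.1 + y.2) @`
    (closure (S @` [set x | `|x| <= 1]) `*` closure (T @` [set x | `|x| <= 1])))).
    apply: continuous_compact; last exact: compact_setX.
    apply: continuous_subspaceT => y; apply: cvgD; last exact: cvg_snd.
    by apply: cvgZr; exact: cvg_fst.
  move=> _ [x /= x1 <-]; exists (S x, T x) => //=.
  by split; apply: subset_closure; exists x.
move=> T clT; rewrite /compact_op/= compact_ultra => F UF FA.
have FF : ProperFilter F by exact: ultra_proper.
suff Fc : cauchy F.
  have Fl : F --> lim F by exact: cauchy_cvg.
  exists (lim F); split=> //.
  by apply: (closed_closure (A := T @` _)) => B /Fl FB; have [z []] := @filter_ex _ _ FF _ (filterI FA FB); exists z.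
apply: cauchy_exP => e e0.
have e40 : 0 < e / 2 / 2 by rewrite !divr_gt0.
have [S [cS]] := clT _ (nbhsx_ballx T _ e40).
rewrite -ball_normE/= => TS.
set C := closure (S @` [set x | `|x| <= 1]) in cS *.
have near y : closure (T @` [set x | `|x| <= 1]) y ->
    exists c, C c /\ `|y - c| < e / 2.
  move=> /(_ _ (nbhsx_ballx y _ e40))[_ [[x /= x1 <-]]].
  rewrite -ball_normE/= => yTx; exists (S x); split.
    by apply: subset_closure; exists x.
  rewrite -(subrKA (T x)) (le_lt_trans (ler_normD _ _))// [ltRHS]splitr ltrD//.
  rewrite (le_lt_trans _ TS)//.
  have := bounded_op_le (T - S) x => /le_trans; apply.
  by rewrite ler_piMr.
have /choice[r rP] : forall y, exists c,
    closure (T @` [set x | `|x| <= 1]) y -> C c /\ `|y - c| < e / 2.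
  by move=> y; have [/near[c cP]|?] := pselect (closure (T @` [set x | `|x| <= 1]) y);
    [exists c|exists y].
have FrC : F (r @^-1` C) by apply: filterS FA => y /rP[].
have [c [_ clc]] := cS (r @ F) _ FrC.
exists c.
have bc : nbhs c (ball c (e / 2 / 2)) by exact: nbhsx_ballx.
have : F (r @^-1` ball c (e / 2 / 2)).
  have [//|Fn] := in_ultra_setVsetC (r @^-1` ball c (e / 2 / 2)) UF.
  by have [z [/= ? ?]] := clc (~` ball c (e / 2 / 2)) _ Fn bc.
move=> /(filterI FA); apply: filterS => y [/rP[_ yr]].
rewrite /= -!ball_normE/= => cr.
rewrite -(subrKA (r y)) (le_lt_trans (ler_normD _ _))//.
rewrite [ltRHS]splitr ltrD//; last by rewrite distrC.
by rewrite (lt_trans cr)// ltr_pdivrMr// mulr_natr mulr2n ltrDl divr_gt0.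
Qed.

End OperatorIdeals.

Arguments ellp {R} k {p} p1.
Arguments compact_op {R k} X Y.

(* Main.v *)
Require Import Defs.
From HB Require Import structures.
From mathcomp Require Import all_boot all_order all_algebra.
From mathcomp Require Import complex ring.
From mathcomp Require Import all_classical all_reals all_analysis.
Set Implicit Arguments.
Unset Strict Implicit.
Unset Printing Implicit Defensive.
Import Order.TTheory GRing.Theory Num.Theory.
Import numFieldNormedType.Exports.
Local Open Scope classical_set_scope.
Local Open Scope ring_scope.

(** Let T be a nonzero operator from l_p to Y and (u_n) a maximizing sequence in
    the unit ball that is not weakly null. Some functional f stays away from 0
    along a subsequence, and an ultrafilter refining that subsequence makes
    every coordinate of u_n converge. The coordinatewise limit v lies in the
    unit ball of l_p, and it is not 0: otherwise u_n would tend to 0 coordinate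
    by coordinate, and for p > 1 a bounded family with that property is weakly
    null ([dual_cvg0]), against the choice of f. Put w_n = u_n - v. The claim
    is that |T v| >= |T| |v|, so that T attains its norm at v / |v|.

    Two facts about l_p are used. A coordinatewise limit splits off in norm,
    lim |w_n|^p + |v|^p <= 1 ([mass_weak_limit_le]), and for every t >= 0
    the upper limit of |t e_0 + w_n| is at most (t^p + lim |w_n|^p)^(1/p).

    The M-ideal hypothesis enters through [M_ideal_approx]: if S is compact
    with |S| <= |T|, then for every d > 0 there is a compact operator A with
    |S + T - A| <= |T| + d and |(T - A) e_0| <= d. Were there none, the
    Hahn-Banach theorem in the product of the operator space with Y would give
    a functional (F, g), of norm at most 1 on the first factor, that vanishes
    on the pairs (A, t A e_0), A compact, and exceeds |T| in modulus at
    (S + T, t T e_0). Put phi(B) = g(t B e_0) and G = F + phi. Then G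
    annihilates the compact operators, while the L-projection P onto their
    annihilator kills phi: phi only sees B e_0, so it already has its full norm
    on operators of rank one. Hence |G| + |phi| = |F| <= 1, and the value of
    (F, g) at that point, which is G T - phi S, has modulus at most |T|: a
    contradiction.

    Now take t = |T v| / |T| and let S be the operator of rank one
    x |-> (x_0 / t) T v, so that S (t e_0) = T v and |S| <= |T|. Up to terms
    that vanish in the limit or are as small as d, T u_n equals
    (S + T - A)(t e_0 + w_n), because the compact operators S and A send w_n
    to 0 in norm ([compact_op_cvg0]). Therefore
    |T| <= |T| (t^p + lim |w_n|^p)^(1/p), that is,
    1 <= t^p + lim |w_n|^p <= t^p + 1 - |v|^p, whence |v| <= t. *)

(** * Infima, scalars and real-valued norms *)

Lemma le_infD (R : realType) (A B : set R) (c : R) :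
  A !=set0 -> B !=set0 -> (forall a b, A a -> B b -> c <= a + b) ->
  c <= inf A + inf B.
Proof.
move=> A0 B0 cAB; rewrite -lerBlDr; apply: lb_le_inf => // a Aa.
rewrite lerBlDr addrC -lerBlDr; apply: lb_le_inf => // b Bb.
by rewrite lerBlDr addrC cAB.
Qed.

Lemma le_infM (R : realType) (A : set R) (c t : R) :
  A !=set0 -> 0 <= t -> (forall a, A a -> c <= t * a) -> c <= t * inf A.
Proof.
move=> A0; rewrite le_eqVlt => /predU1P[<-|t0] cA.
  by case: A0 => a /cA; rewrite !mul0r.
rewrite mulrC -ler_pdivrMr//; apply: lb_le_inf => // a Aa.
by rewrite ler_pdivrMr// mulrC cA.
Qed.

Lemma normr_re_complex (R : realType) (a : R[i]) :
  normr_re (a : (scalars R ComplexScalars)^o) =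
  Num.sqrt (complex.Re a ^+ 2 + complex.Im a ^+ 2).
Proof. by case: a. Qed.

Section Scalars.
Context (R : realType) (k : scalar_kind).
Local Notation K := (scalars R k).
Local Notation of_ := (@scalar_of R k).

Lemma scalar_ofN (x : R) : of_ (- x) = - of_ x.
Proof. by apply/eqP; rewrite -addr_eq0 -scalar_ofD addNr scalar_of0. Qed.

Lemma normr_re_of (x : R) : normr_re (of_ x : K^o) = `|x|.
Proof. by case: k => //; rewrite normr_re_complex /= expr0n addr0 sqrtr_sqr. Qed.

Lemma normr_reN (V : normedModType K) (x : V) : normr_re (- x) = normr_re x.
Proof. by rewrite /normr_re normrN. Qed.

Lemma normr_reB (V : normedModType K) (x y : V) :
  normr_re (x - y) <= normr_re x + normr_re y.
Proof. by rewrite -(normr_reN y); exact: normr_reD. Qed.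

Lemma normr_re_leP (V : normedModType K) (x : V) (c : R) :
  (normr_re x <= c) = (`|x| <= of_ c).
Proof. by rewrite normr_reE scalar_of_le. Qed.

(** Multiplying by a unimodular scalar turns any scalar into its modulus; this
    is how statements about moduli are reduced to statements about real
    parts. *)
Lemma exists_phase (z : K) : exists2 a : K,
  normr_re (a : K^o) = 1 & a * z = of_ (normr_re (z : K^o)).
Proof.
have [->|z0] := eqVneq z 0.
  exists 1; last by rewrite mulr0 (normr_re0 K^o) scalar_of0.
  by rewrite -(scalar_of1 k) normr_re_of normr1.
exists (`|z| / z); last by rewrite divfK// -normr_reE.
apply: (can_inj (scalar_ofK k)); rewrite -normr_reE scalar_of1.
by rewrite -[LHS]/(`|_ : K|) normf_div normr_id divff// normr_eq0.
Qed.

End Scalars.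

(** * The Hahn-Banach theorem over both scalar fields *)

Section Sublinear.
Context (R : realType) (k : scalar_kind) (V : lmodType (scalars R k)).
Local Notation K := (scalars R k).
Local Notation of_ := (@scalar_of R k).
Implicit Types (p q : V -> R) (x y z : V).

(** The space is a module over [scalars R k]; only its real scalars matter
    here, so that the real theorem also serves complex spaces. Homogeneity is
    required as an inequality, which is what infima preserve directly;
    [sublinearZ] recovers the equality. *)
Definition sublinear p :=
  (forall x y, p (x + y) <= p x + p y) /\
  (forall t x, 0 <= t -> p (of_ t *: x) <= t * p x).

Lemma sublinear0 p : sublinear p -> p 0 = 0.
Proof.
move=> [pD pZ]; apply/eqP; rewrite eq_le; apply/andP; split.
  by have := pZ 0 0 (lexx _); rewrite scaler0 mul0r.
by have := pD 0 0; rewrite addr0 -{1}[p 0]addr0 lerD2l.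
Qed.

Lemma sublinear_geN p x : sublinear p -> - p (- x) <= p x.
Proof.
move=> sp; have [pD _] := sp.
by rewrite -subr_ge0 opprK; have := pD x (- x); rewrite subrr (sublinear0 sp).
Qed.

Lemma sublinearZ p t x : sublinear p -> 0 <= t -> p (of_ t *: x) = t * p x.
Proof.
move=> sp; rewrite le_eqVlt => /predU1P[<-|t0].
  by rewrite scalar_of0 scale0r mul0r sublinear0.
apply/eqP; rewrite eq_le (sp.2 t x (ltW t0)) /= -ler_pdivlMl//.
have := sp.2 t^-1 (of_ t *: x); rewrite invr_ge0 ltW// => /(_ isT).
by rewrite scalerA -scalar_ofM mulVf ?gt_eqF// scalar_of1 scale1r.
Qed.

Definition descent_set p y x : set R :=
  [set p (x + of_ t *: y) - t * p y | t in [set t | 0 <= t]].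

(** The largest sublinear functional below [p] whose value at [- y] is at most
    [- p y]. A minimal [p] must therefore coincide with it for every [y], and
    this forces [p] to be odd. *)
Definition descent p y x : R := inf (descent_set p y x).

Lemma descent_set_nonempty p y x : descent_set p y x !=set0.
Proof. by exists (p (x + of_ 0 *: y) - 0 * p y), 0 => /=. Qed.

Lemma descent_le_at p y x t : sublinear p -> 0 <= t ->
  descent p y x <= p (x + of_ t *: y) - t * p y.
Proof.
move=> sp t0; apply: ge_inf; last by exists t.
exists (- p (- x)) => _ [s /= s0 <-].
rewrite -(sublinearZ y sp s0) lerBrDr addrC -lerBrDr opprK.
apply: le_trans (sp.1 _ _).
by rewrite [x + _]addrC addrK.
Qed.

Lemma descent_le p y x : sublinear p -> descent p y x <= p x.
Proof.
move=> sp; have := descent_le_at y x sp (lexx 0).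
by rewrite scalar_of0 scale0r addr0 mul0r subr0.
Qed.

Lemma descentN p y : sublinear p -> descent p y (- y) <= - p y.
Proof.
move=> sp; have := descent_le_at y (- y) sp ler01.
by rewrite scalar_of1 scale1r addNr mul1r (sublinear0 sp) sub0r.
Qed.

Lemma descent_sublinear p y : sublinear p -> sublinear (descent p y).
Proof.
move=> sp; split=> [x x'|c x c0].
  apply: le_infD; [exact: descent_set_nonempty..|].
  move=> _ _ [s /= s0 <-] [t /= t0 <-].
  apply: (le_trans (descent_le_at y _ sp (addr_ge0 s0 t0))).
  rewrite mulrDl addrACA -opprD lerD2r.
  by rewrite scalar_ofD scalerDl addrACA sp.1.
apply: le_infM => //; first exact: descent_set_nonempty.
move=> _ [t /= t0 <-].
apply: (le_trans (descent_le_at y _ sp (mulr_ge0 c0 t0))).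
by rewrite mulrBr mulrA lerD2r scalar_ofM -scalerA -scalerDr sp.2.
Qed.

(** Zorn's lemma for the reversed pointwise order: sublinear functionals below
    [q] are bounded below by [x |-> - q (- x)], so a chain has a pointwise
    infimum, and it is sublinear because the chain is totally ordered. *)
Lemma exists_minimal_sublinear q : sublinear q ->
  exists2 p, sublinear p /\ (forall x, p x <= q x) &
    forall p', sublinear p' -> (forall x, p' x <= p x) -> p' = p.
Proof.
move=> sq.
pose T := {p : V -> R | `[< sublinear p /\ forall x, p x <= q x >]}.
pose r (p p' : T) := `[< forall x, sval p' x <= sval p x >].
have TP (p : T) : sublinear (sval p) /\ forall x, sval p x <= q x.
  exact/asboolP/(svalP p).
have [||||[m mP] mmin] := @Zorn T r.
- by move=> p; apply/asboolP.
- move=> p1 p2 p3 /asboolP h12 /asboolP h23; apply/asboolP => x.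
  exact: le_trans (h12 x).
- move=> p1 p2 /asboolP h12 /asboolP h21; apply: val_inj; apply/funext => x /=.
  by apply/eqP; rewrite eq_le h12 h21.
- move=> A totA; have [[a0 Aa0]|A0] := pselect (A !=set0); last first.
    exists (exist _ q (introT (asboolP _) (conj sq (fun x => lexx (q x))))).
    by move=> s As; exfalso; apply: A0; exists s.
  pose V_ x : set R := [set sval s x | s in A].
  have V0 x : V_ x !=set0 by exists (sval a0 x), a0.
  have Vlb x : has_lbound (V_ x).
    exists (- q (- x)) => _ [p Ap <-].
    have [sp pq] := TP p; apply: le_trans (sublinear_geN x sp).
    by rewrite lerN2.
  pose i x := inf (V_ x).
  have iA (s : T) x : A s -> i x <= sval s x by move=> As; apply: ge_inf => //; exists s.
  suff iP : `[< sublinear i /\ forall x, i x <= q x >].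
    by exists (exist _ i iP) => s As; apply/asboolP => x /=; exact: iA.
  apply/asboolP; split; last first.
    by move=> x; apply: (le_trans (iA _ x Aa0)); have [] := TP a0.
  split=> [x y|t x t0].
    apply: le_infD => // _ _ [p1 A1 <-] [p2 A2 <-].
    have [[p1D _] _] := TP p1; have [[p2D _] _] := TP p2.
    have [/asboolP h|/asboolP h] := totA p1 p2 A1 A2.
      by apply: (le_trans (iA _ _ A2)); apply: (le_trans (p2D _ _)); rewrite lerD2r.
    by apply: (le_trans (iA _ _ A1)); apply: (le_trans (p1D _ _)); rewrite lerD2l.
  apply: le_infM => // _ [p Ap <-]; apply: (le_trans (iA _ _ Ap)).
  by have [[_ +] _] := TP p; apply.
exists m; first exact: (elimT (asboolP _) mP).
move=> p' sp' p'm.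
have p'P : `[< sublinear p' /\ forall x, p' x <= q x >].
  apply/asboolP; split=> // x; apply: (le_trans (p'm x)).
  by have /asboolP[_ +] := mP; apply.
by have := mmin (exist _ p' p'P) (introT (asboolP _) p'm); move=> /(congr1 sval).
Qed.

(** A minimal sublinear functional is odd, hence linear. Starting the
    minimization from [descent q z] instead of [q] bounds the value at [- z]
    by [- q z], which is what makes [q z] attained. *)
Theorem Hahn_Banach_real q z : sublinear q ->
  exists h : V -> R, [/\ forall x y, h (x + y) = h x + h y,
    forall t x, h (of_ t *: x) = t * h x, forall x, h x <= q x & h z = q z].
Proof.
move=> sq.
have [h [sh hq] hmin] := exists_minimal_sublinear (descent_sublinear z sq).
have hN x : h (- x) = - h x.
  apply/eqP; rewrite eq_le; apply/andP; split.
    have <- : descent h x = h.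
      by apply: hmin; [exact: descent_sublinear | move=> y; exact: descent_le].
    by rewrite {2}(hmin _ (descent_sublinear x sh) (fun y => descent_le x y sh)) descentN.
  by rewrite lerNl; exact: sublinear_geN.
have hle x : h x <= q x by apply: (le_trans (hq x)); exact: descent_le.
exists h; split=> //.
- move=> x y; apply/eqP; rewrite eq_le sh.1 /=.
  by rewrite -lerN2 -hN !opprD -(hN x) -(hN y) sh.1.
- move=> t x; have [t0|/ltW t0] := leP 0 t; first exact: sublinearZ.
  rewrite -[t]opprK scalar_ofN scaleNr hN mulNr; congr (- _).
  by rewrite sublinearZ// oppr_ge0.
- apply/eqP; rewrite eq_le hle/= -lerN2 -hN.
  by apply: (le_trans (hq _)); exact: descentN.
Qed.

End Sublinear.

(** In the complex case the real functional [h] is the real part of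
    [H x = h x - i h (i x)]; rotating [H x] to its modulus transfers the bound
    from [h] to [H]. *)
Theorem Hahn_Banach_seminorm (R : realType) (k : scalar_kind)
    (V : lmodType (scalars R k)) (q : V -> R) (z : V) :
  (forall x y, q (x + y) <= q x + q y) ->
  (forall a x, q (a *: x) <= normr_re (a : (scalars R k)^o) * q x) ->
  exists H : V -> (scalars R k)^o, [/\ linear H,
    forall x, normr_re (H x) <= q x & q z <= normr_re (H z)].
Proof.
case: k V q z => V q z qD qZ.
  have sq : sublinear q.
    split=> // t x t0; apply: (le_trans (qZ _ _)).
    by rewrite (normr_re_of RealScalars t) ger0_norm.
  have [h [hD hZ hq hz]] := Hahn_Banach_real z sq.
  exists h; split=> [a x y|x|]; first by rewrite hD (hZ a).
  - rewrite /normr_re /= ler_norml hq andbT lerNl.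
    have -> : - h x = h (- x).
      by rewrite -scaleN1r (hZ (-1)) mulN1r.
    rewrite -scaleN1r (le_trans (hq _))// (le_trans (qZ _ _))//.
    by rewrite (normr_re_of RealScalars (-1)) normrN1 mul1r.
  by rewrite -hz /normr_re /= ler_norm.
have sq : sublinear q.
  split=> // t x t0; apply: (le_trans (qZ _ _)).
  by rewrite (normr_re_of ComplexScalars t) ger0_norm.
have [h [hD hZ hq hz]] := Hahn_Banach_real z sq.
pose C := scalars R ComplexScalars.
pose H x : C^o := Complex (h x) (- h ('i%C *: x)).
have hN x : h (- x) = - h x.
  by have := hZ (-1) x; rewrite scalar_ofN scaleN1r mulN1r.
have HD x y : H (x + y) = H x + H y.
  rewrite /H scalerDr !hD; apply/eqP; rewrite eq_complex /= eqxx /=.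
  by rewrite opprD.
have HZ a x : H (a *: x) = a * H x.
  have ha c d y : h (Complex c d *: y) = c * h y + d * h ('i%C *: y).
    rewrite -!hZ -hD scalerA -scalerDl; congr (h (_ *: _)).
    by apply/eqP; rewrite eq_complex /=; apply/andP; split; apply/eqP; ring.
  case: a => c d; rewrite /H scalerA [('i * _)%C]mulrC -scalerA (ha c d x) (ha c d ('i%C *: x)).
  rewrite scalerA -[('i * 'i)%C]expr2 sqr_i scaleN1r hN.
  by apply/eqP; rewrite eq_complex /=; apply/andP; split; apply/eqP; ring.
have H1 x : normr_re (H x) <= q x.
  have [a na aH] := @exists_phase R ComplexScalars (H x).
  rewrite -[q x]mul1r -na; apply: le_trans (qZ _ _); apply: le_trans (hq _).
  by rewrite -[h _]/(complex.Re (H (a *: x))) HZ aH.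
exists H; split=> //.
  by move=> a x y; rewrite HD HZ.
rewrite -hz (le_trans (ler_norm _))// normr_re_complex/=.
by rewrite -sqrtr_sqr ler_wsqrtr// lerDl sqr_ge0.
Qed.

(** * Bounded operators and separating functionals *)

Section Operators.
Context (R : realType) (k : scalar_kind).
Local Notation K := (scalars R k).
Local Notation of_ := (@scalar_of R k).

Lemma normr_re_opE (X Y : normedModType K) (T : bounded_op X Y) :
  normr_re T = sup (opnorm_set T).
Proof. by rewrite /normr_re -[`|T|]/(opnorm T) scalar_ofK. Qed.

Lemma normr_re_op_le (X Y : normedModType K) (T : bounded_op X Y) (x : X) :
  normr_re (T x) <= normr_re T * normr_re x.
Proof. by rewrite normr_re_opE normr_re_le_sup. Qed.

Lemma normr_re_op_lub (X Y : normedModType K) (T : bounded_op X Y) (M : R) :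
  0 <= M -> (forall x, normr_re (T x) <= M * normr_re x) -> normr_re T <= M.
Proof. by move=> M0 TM; rewrite normr_re_opE sup_opnorm_set_le. Qed.

Lemma linear_bounded_op (X Y : normedModType K) (f : X -> Y) (C : R) :
  linear f -> (forall x, normr_re (f x) <= C * normr_re x) ->
  exists T : bounded_op X Y, forall x, T x = f x.
Proof.
move=> lf fC.
pose g : {linear X -> Y} := HB.pack f (GRing.isLinear.Build K X Y *:%R f lf).
suff cf : continuous f.
  have fP : f \in @bounded_op_pred R k X Y by apply/asboolP.
  by exists (BoundedOp fP).
apply/(linear_bounded_continuous g)/linear_boundedP.
exists (of_ C); split; first by rewrite realE -(scalar_of0 k) !scalar_of_le -realE num_real.
move=> r Cr x; apply: (@le_trans _ _ (of_ C * `|x|)).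
  by rewrite [`|x|]normr_reE -scalar_ofM -normr_re_leP fC.
by rewrite ler_wpM2r// ltW.
Qed.

(** The seminorm to extend is the distance to [M]: it vanishes on [M], and so
    must every functional that it dominates. *)
Lemma Hahn_Banach_separation (E : normedModType K) (M : set E) (z : E) (d : R) :
  M 0 -> (forall (a : K) x y, M x -> M y -> M (a *: x + y)) ->
  (forall m, M m -> d <= normr_re (z - m)) ->
  exists H : dual_space E, [/\ forall m, M m -> H m = 0,
    forall x, normr_re (H x) <= normr_re x & d <= normr_re (H z)].
Proof.
move=> M0 MZD dM.
pose D x : set R := [set normr_re (x - m) | m in M].
have D0 x : D x !=set0 by exists (normr_re (x - 0)), 0.
have Dlb x : has_lbound (D x) by exists 0 => _ [m _ <-]; exact: normr_re_ge0.
pose q x := inf (D x).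
have qM x m : M m -> q x <= normr_re (x - m) by move=> Mm; apply: ge_inf => //; exists m.
have [||H [lH Hq Hz]] := @Hahn_Banach_seminorm R k E q z.
- move=> x y; apply: le_infD => // _ _ [m Mm <-] [n Mn <-].
  have MD : M (m + n) by rewrite -[m]scale1r; exact: MZD.
  by apply: (le_trans (qM _ _ MD)); rewrite opprD addrACA normr_reD.
- move=> a x; apply: le_infM => //; first exact: normr_re_ge0.
  move=> _ [m Mm <-].
  have MZ : M (a *: m) by rewrite -[_ *: _]addr0; exact: MZD.
  by apply: (le_trans (qM _ _ MZ)); rewrite -scalerBr normr_reZ.
have HE x : normr_re (H x) <= 1 * normr_re x.
  by rewrite mul1r (le_trans (Hq x))// -{2}[x]subr0 qM.
have [H' H'E] := linear_bounded_op lH HE.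
exists H'; split=> [m Mm|x|]; rewrite H'E.
- apply: normr_re_eq0; apply/eqP; rewrite eq_le normr_re_ge0 andbT.
  by rewrite (le_trans (Hq m))// (le_trans (qM _ _ Mm))// subrr normr_re0.
- by have := HE x; rewrite mul1r.
- apply: le_trans Hz; apply: lb_le_inf => // _ [m Mm <-]; exact: dM.
Qed.

Lemma dual_separates (E : normedModType K) (x : E) :
  (forall f : dual_space E, f x = 0) -> x = 0.
Proof.
move=> fx0; apply: normr_re_eq0; apply/eqP; rewrite eq_le normr_re_ge0 andbT.
have [|||f [_ _]] := @Hahn_Banach_separation E [set 0] x (normr_re x) => //.
- by move=> a u v -> ->; rewrite /= scaler0 addr0.
- by move=> m ->; rewrite subr0.
by rewrite fx0 (normr_re0 K^o).
Qed.

End Operators.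

(** * The geometry of l_p *)

Lemma ler_powR2r (R : realType) (p x y : R) : 0 < p -> 0 <= x -> 0 <= y ->
  (x `^ p <= y `^ p) = (x <= y).
Proof.
move=> p0 x0 y0; apply/idP/idP => [|xy].
  by apply: contraTT; rewrite -!ltNge => /gt0_ltr_powR; apply; rewrite ?nnegrE.
by apply: ge0_ler_powR; rewrite ?nnegrE// ltW.
Qed.

Lemma powRVK (R : realType) (p x : R) : (p == 0) = false -> 0 <= x -> (x `^ p^-1) `^ p = x.
Proof. by move=> p0 x0; rewrite -powRrM mulVf ?p0// powRr1. Qed.

Lemma cvg_powR (R : realType) (T : Type) (F : set_system T) {FF : Filter F}
    (f : T -> R) (l r : R) : 0 < r -> (forall t, 0 <= f t) -> 0 <= l ->
  f t @[t --> F] --> l -> f t `^ r @[t --> F] --> l `^ r.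
Proof.
move=> r0 f0; rewrite le_eqVlt => /predU1P[<-|l0] fl.
  rewrite powR0 ?gt_eqF//; apply/cvgrPdist_lt => e e0.
  have er0 : 0 < e `^ r^-1 by exact: powR_gt0.
  move/cvgrPdist_lt/(_ _ er0) : fl; apply: filterS => t.
  rewrite !sub0r !normrN !ger0_norm ?powR_ge0// => fe.
  rewrite -(powRVK (gt_eqF r0) (ltW e0)).
  by apply: gt0_ltr_powR; rewrite // ?nnegrE// powR_ge0.
apply: (@continuous_cvg _ _ _ _ _ _ (fun x => x `^ r)) => //.
apply: differentiable_continuous; apply/derivable1_diffP.
by apply: derivable_powR; rewrite in_itv/= andbT.
Qed.

Fact mass_key : unit. Proof. by []. Qed.

Section EllpGeometry.
Context (R : realType) (k : scalar_kind) (p : R) (p1 : 1 <= p).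
Local Notation K := (scalars R k).
Local Notation of_ := (@scalar_of R k).
Local Notation lp := (ellp k p1).
Implicit Types (x y : lp) (A : pred nat) (N : nat).

Let p0 : 0 < p. Proof. exact: lt_le_trans p1. Qed.
Let pN0 : (p == 0) = false. Proof. by rewrite gt_eqF. Qed.

(** The p-th power of the norm, which is additive on disjoint supports. It is
    locked because comparing two such values by conversion would unfold the
    series. *)
Definition mass x : R := locked_with mass_key (fine (pth_power_sum p x)).

Lemma massE x : normr_re x = mass x `^ p^-1.
Proof.
by rewrite [mass x]unlock /normr_re -[`|x|]/(ellp_norm x) scalar_ofK.
Qed.

Lemma mass_ge0 x : 0 <= mass x.
Proof. by rewrite [mass x]unlock fine_ge0// pth_power_sum_ge0. Qed.

Lemma powR_normr_re x : normr_re x `^ p = mass x.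
Proof. by rewrite massE powRVK// mass_ge0. Qed.

Lemma pth_power_sumE x : pth_power_sum p x = (mass x)%:E.
Proof. by rewrite [mass x]unlock fineK// pth_power_sum_fin. Qed.

Lemma ler_mass x y : (normr_re x <= normr_re y) = (mass x <= mass y).
Proof. by rewrite -!powR_normr_re ler_powR2r ?normr_re_ge0. Qed.

Lemma mass_le1 x : normr_re x <= 1 -> mass x <= 1.
Proof.
move=> x1; rewrite -powR_normr_re.
by rewrite (le_trans (ge0_ler_powR (ltW p0) _ _ x1)) ?powR1 ?nnegrE ?normr_re_ge0.
Qed.

Lemma powR_normr_re_ge0 (n : nat) (x : nat -> K) :
  (0 <= (normr_re (x n : K^o) `^ p)%:E)%E.
Proof. by rewrite lee_fin powR_ge0. Qed.

Lemma ellp_pred_bounded (x : nat -> K) (C : R) :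
  (forall N, \sum_(i < N) normr_re (x i : K^o) `^ p <= C) -> x \in @ellp_pred R k p.
Proof.
move=> xC; rewrite unfold_in /ellp_pred; apply: (@le_lt_trans _ _ C%:E); last exact: ltry.
apply: lime_le.
  by apply: is_cvg_nneseries => i _ _; exact: powR_normr_re_ge0.
by apply: nearW => N; rewrite big_mkord sumEFin lee_fin.
Qed.

Lemma restrict_subproof A x :
  (fun i => if A i then x i else 0) \in @ellp_pred R k p.
Proof.
rewrite unfold_in /ellp_pred; apply: le_lt_trans (ellp_funP x).
apply: lee_nneseries => [i _ _|i _]; first by rewrite lee_fin powR_ge0.
by rewrite lee_fin; case: (A i) => //; rewrite (normr_re0 K^o) powR0 ?pN0 ?powR_ge0.
Qed.

Definition restrict A x : lp := Ellp p1 (restrict_subproof A x).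

Lemma ellpP x y : (forall i, x i = y i) -> x = y.
Proof. by move=> xy; apply/val_inj/funext. Qed.

Lemma restrict_add A x : restrict A x + restrict (predC A) x = x.
Proof.
apply: ellpP => i; rewrite -[LHS]/(restrict A x i + restrict (predC A) x i) /=.
by case: (A i); rewrite /= ?addr0 ?add0r.
Qed.

Lemma restrictD A x y : restrict A (x + y) = restrict A x + restrict A y.
Proof.
apply: ellpP => i; rewrite -[RHS]/(restrict A x i + restrict A y i) /=.
by case: (A i); rewrite //= addr0.
Qed.

Lemma restrictZ A (a : K) x : restrict A (a *: x) = a *: restrict A x.
Proof.
apply: ellpP => i; rewrite -[RHS]/(a * restrict A x i) /=.
by case: (A i); rewrite //= mulr0.
Qed.

Lemma restrictB A x y : restrict A (x - y) = restrict A x - restrict A y.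
Proof. by rewrite restrictD -scaleN1r restrictZ scaleN1r. Qed.

Lemma restrict0 A : restrict A 0 = 0.
Proof. by rewrite -(scale0r 0) restrictZ !scale0r. Qed.

Lemma restrictC A B x : restrict A (restrict B x) = restrict B (restrict A x).
Proof. by apply: ellpP => i /=; case: (A i); rewrite ?if_same. Qed.

Lemma mass_split A x :
  mass x = mass (restrict A x) + mass (restrict (predC A) x).
Proof.
apply: EFin_inj; rewrite EFinD -!pth_power_sumE.
rewrite /pth_power_sum -(nneseriesD (fun i _ _ => powR_normr_re_ge0 i (restrict A x))
  (fun i _ _ => powR_normr_re_ge0 i (restrict (predC A) x))).
apply: eq_eseriesr => i _; rewrite -EFinD; congr EFin; rewrite /=.
by case: (A i); rewrite /= (normr_re0 K^o) powR0 ?pN0// ?addr0 ?add0r.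
Qed.

Lemma normr_re_restrict_le A x : normr_re (restrict A x) <= normr_re x.
Proof. by rewrite ler_mass (mass_split A x) lerDl mass_ge0. Qed.

Definition cutoff N x := restrict [pred i | (i < N)%N] x.
Definition tail N x := restrict (predC [pred i | (i < N)%N]) x.

Lemma cutoff_tail N x : cutoff N x + tail N x = x.
Proof. exact: restrict_add. Qed.

Lemma tail_cutoff N x : tail N (cutoff N x) = 0.
Proof. by apply: ellpP => i /=; case: (i < N)%N. Qed.

Lemma cutoff_of_tail N x : cutoff N (tail N x) = 0.
Proof. by apply: ellpP => i /=; case: (i < N)%N. Qed.

Lemma mass_cutoff_tail N x : mass x = mass (cutoff N x) + mass (tail N x).
Proof. exact: mass_split. Qed.

Lemma mass_cutoff N x : mass (cutoff N x) = \sum_(i < N) normr_re (x i : K^o) `^ p.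
Proof.
apply: EFin_inj; rewrite -pth_power_sumE /pth_power_sum.
rewrite (nneseries_split 0 N (fun i _ => powR_normr_re_ge0 i (cutoff N x))).
rewrite add0n eseries0 ?adde0; last first.
  by move=> i Ni _; rewrite /= ltnNge Ni /= (normr_re0 K^o) powR0 ?pN0.
by rewrite big_mkord sumEFin; congr EFin; apply: eq_bigr => i _ /=; rewrite ltn_ord.
Qed.

Lemma normr_re_coord_le i x : normr_re (x i : K^o) <= normr_re x.
Proof.
rewrite -(ler_powR2r p0) ?normr_re_ge0// powR_normr_re (mass_cutoff_tail i.+1).
rewrite mass_cutoff big_ord_recr/= -addrA addrCA lerDl addr_ge0 ?mass_ge0//.
by apply: sumr_ge0 => j _; rewrite powR_ge0.
Qed.

(** An inequality that suffices to let the first [N] coordinates tend to 0 by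
    induction on [N]. *)
Lemma normr_re_cutoffS N x :
  normr_re (cutoff N.+1 x) <= normr_re (cutoff N x) + normr_re (x N : K^o).
Proof.
have -> : cutoff N.+1 x = cutoff N x + restrict (pred1 N) x.
  apply: ellpP => i; rewrite -[RHS]/(cutoff N x i + restrict (pred1 N) x i) /= ltnS.
  by case: ltngtP => _; rewrite ?addr0 ?add0r.
apply: (le_trans (normr_reD _ _)); rewrite lerD2l.
rewrite -(ler_powR2r p0) ?normr_re_ge0// powR_normr_re (mass_cutoff_tail N.+1) mass_cutoff.
have -> : tail N.+1 (restrict (pred1 N) x) = 0.
  by apply: ellpP => i /=; case: ltnP => //= Ni; rewrite gtn_eqF.
rewrite -(powR_normr_re 0) (normr_re0 lp) powR0 ?pN0// addr0 big_ord_recr/= eqxx.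
rewrite big1 ?add0r// => i _.
by rewrite ltn_eqF// (normr_re0 K^o) powR0 ?pN0.
Qed.

Lemma tail_cvg0 x : normr_re (tail N x) @[N --> \oo] --> (0 : R).
Proof.
have sx : \sum_(i < N) normr_re (x i : K^o) `^ p @[N --> \oo] --> mass x.
  have := @is_cvg_nneseries _ (fun i => (normr_re (x i : K^o) `^ p)%:E) xpredT 0
    (fun i _ _ => powR_normr_re_ge0 i x).
  rewrite -[limn _]/(pth_power_sum p x) pth_power_sumE => /fine_cvg.
  by under eq_fun do rewrite big_mkord sumEFin.
have tx : mass (tail N x) @[N --> \oo] --> (0 : R).
  have -> : (fun N => mass (tail N x)) =
      (fun N => mass x - \sum_(i < N) normr_re (x i : K^o) `^ p).
    by apply/funext => N; rewrite (mass_cutoff_tail N x) mass_cutoff addrC addKr.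
  by have := cvgB (cvg_cst (mass x)) sx; rewrite subrr; exact.
have ip0 : 0 < p^-1 by rewrite invr_gt0.
have -> : (fun N => normr_re (tail N x)) = (fun N => mass (tail N x) `^ p^-1).
  by apply/funext => N; exact: massE.
have := cvg_powR ip0 (fun N => mass_ge0 (tail N x)) (lexx 0) tx.
by rewrite powR0 ?invr_eq0 ?pN0 //; apply.
Qed.

Lemma unit0_subproof : (fun i => if i == 0%N then 1 else 0) \in @ellp_pred R k p.
Proof.
apply: (@ellp_pred_bounded _ 1) => -[|N]; first by rewrite big_ord0.
rewrite big_ord_recl/= big1 ?addr0 => [|i _].
  by rewrite -(scalar_of1 k) normr_re_of normr1 powR1.
by rewrite (normr_re0 K^o) powR0 ?pN0.
Qed.

Definition unit0 : lp := Ellp p1 unit0_subproof.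

Lemma cutoff1_unit0 : cutoff 1 unit0 = unit0.
Proof. by apply: ellpP => -[]. Qed.

Lemma normr_re_unit0 : normr_re unit0 = 1.
Proof.
rewrite massE -cutoff1_unit0 mass_cutoff big_ord1 /= -(scalar_of1 k) normr_re_of.
by rewrite normr1 !powR1.
Qed.

Lemma massD_disjoint N x y : tail N x = 0 -> cutoff N y = 0 ->
  mass (x + y) = mass x + mass y.
Proof.
move=> x0 y0; rewrite (mass_cutoff_tail N (x + y)) /cutoff /tail !restrictD.
rewrite -!/(cutoff N _) -!/(tail N _) x0 y0 addr0 add0r.
by rewrite -{2}(cutoff_tail N x) -{2}(cutoff_tail N y) x0 y0 addr0 add0r.
Qed.

Lemma tail1_unit0 : tail 1 unit0 = 0.
Proof. by apply: (addrI (cutoff 1 unit0)); rewrite cutoff_tail cutoff1_unit0 addr0. Qed.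

Lemma cutoff0 x : cutoff 0 x = 0.
Proof. exact: ellpP. Qed.

Lemma tail_eq0_le N M x : (N <= M)%N -> tail N x = 0 -> tail M x = 0.
Proof.
move=> NM x0; apply: ellpP => i /=; case: ltnP => //= Mi.
have /(congr1 (fun y : lp => y i)) := x0.
by rewrite /= ltnNge (leq_trans NM Mi).
Qed.

Lemma cutoff_cvg0 (T : Type) (U : set_system T) {FU : Filter U} (w : T -> lp) N :
  (forall i, normr_re (w t i : K^o) @[t --> U] --> (0 : R)) ->
  normr_re (cutoff N (w t)) @[t --> U] --> (0 : R).
Proof.
move=> w_coord; elim: N => [|N ih].
  under eq_fun do rewrite cutoff0 (normr_re0 lp); exact: cvg_cst.
have h : normr_re (cutoff N (w t)) + normr_re (w t N : K^o) @[t --> U] --> (0 : R).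
  by rewrite -[X in _ --> X]addr0; apply: cvgD.
apply: squeeze_cvgr (cvg_cst 0) h; apply: nearW => t.
by rewrite normr_re_ge0 normr_re_cutoffS.
Qed.

End EllpGeometry.

(** * Weak convergence in l_p, p > 1 *)

Lemma no_sublinear_growth (R : realType) (p c C : R) : 1 < p -> 0 < c ->
  ~ forall m : nat, m%:R * c <= C * m%:R `^ p^-1.
Proof.
move=> p1 c0 mC; have p0 : 0 < p by exact: lt_trans p1.
pose s := 1 - p^-1.
have s0 : 0 < s by rewrite subr_gt0 invf_lt1.
pose b := `|C / c| + 1.
have b0 : 0 <= b by rewrite addr_ge0.
have := archi_boundP (powR_ge0 b s^-1).
set m := Num.bound _ => bm.
have m0 : 0 < (m%:R : R) by apply: le_lt_trans bm; exact: powR_ge0.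
have bms : b <= m%:R `^ s.
  rewrite -(powRVK (gt_eqF s0) b0) ler_powR2r ?powR_ge0 ?ler0n//.
  exact: ltW.
have m1 : (m%:R : R) = m%:R `^ s * m%:R `^ p^-1.
  by rewrite -powRD ?subrK ?powRr1 ?ler0n// oner_eq0.
have := mC m; rewrite {1}m1 mulrAC ler_pM2r ?powR_gt0// -ler_pdivlMr// => msC.
have := le_trans bms msC; rewrite /b leNgt => /negP; apply.
by rewrite (le_lt_trans (ler_norm _))// ltrDl.
Qed.

Section WeakConvergence.
Context (R : realType) (k : scalar_kind) (p : R) (p1 : 1 < p).
Local Notation K := (scalars R k).
Local Notation of_ := (@scalar_of R k).
Local Notation lp := (ellp k (ltW p1)).

(** The tails of a functional on l_p tend to 0 in norm. Otherwise there are
    infinitely many disjoint finite blocks in the unit ball on which [F] is at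
    least [e / 2]; the sum of [m] of them has norm at most [m `^ p^-1] and value
    at least [m * (e / 2)], which is impossible for large [m] when p > 1. *)
Lemma dual_small_on_tails (F : dual_space lp) (e : R) : 0 < e ->
  exists N, forall x, cutoff N x = 0 -> normr_re (F x) <= e * normr_re x.
Proof.
move=> e0; apply: contrapT => /forallNP notail.
have p0 : 0 < p by exact: lt_trans p1.
have c0 : 0 < e / 2 by rewrite divr_gt0.
have block N : exists z M, [/\ cutoff N z = 0, tail M z = 0, normr_re z <= 1 &
    exists2 r, F z = of_ r & e / 2 <= r].
  have /existsNP[x /not_implyP[x0 /negP]] := notail N; rewrite -ltNge => ex.
  have nx0 : 0 < normr_re x.
    rewrite lt0r normr_re_ge0 andbT; apply: contraTneq ex => nx0.
    by rewrite (normr_re_eq0 nx0) linear0 (normr_re0 K^o) normr_re0 mulr0 ltxx.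
  pose y : lp := of_ (normr_re x)^-1 *: x.
  have ny : normr_re y = 1.
    by rewrite normr_reZ normr_re_of ger0_norm ?invr_ge0 ?ltW// mulVf ?gt_eqF.
  have Fy : e < normr_re (F y).
    rewrite linearZ (normr_reZ _ (F x : K^o)) normr_re_of ger0_norm ?invr_ge0 ?ltW//.
    by rewrite mulrC ltr_pdivlMr.
  (* The block is a finite section of y, long enough to lose at most e / 2. *)
  have [M FM] : exists M, normr_re F * normr_re (tail M y) <= e / 2.
    have Ft : normr_re F * normr_re (tail M y) @[M --> \oo] --> normr_re F * 0.
      by apply: cvgM; [exact: cvg_cst|exact: tail_cvg0].
    move/cvgrPdist_le/(_ _ c0) : Ft => [M _ /(_ M (leqnn M))].
    rewrite mulr0 sub0r normrN ger0_norm ?mulr_ge0 ?normr_re_ge0// => FM.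
    by exists M.
  have [a na aF] := exists_phase (F (cutoff M y)).
  exists (a *: cutoff M y), M; split.
  - by rewrite /cutoff restrictZ restrictC restrictZ -/(cutoff N x) x0 scaler0
      restrict0 scaler0.
  - by rewrite /tail restrictZ -/(tail _ _) tail_cutoff scaler0.
  - by rewrite normr_reZ na mul1r (le_trans (normr_re_restrict_le _ _)) ?ny.
  exists (normr_re (F (cutoff M y))); first by rewrite linearZ.
  have := normr_reD (F (cutoff M y)) (F (tail M y)).
  rewrite -linearD cutoff_tail => Fyle.
  rewrite -(lerD2r (e / 2)) -splitr (le_trans (ltW (lt_le_trans Fy Fyle)))// lerD2l.
  exact: le_trans (normr_re_op_le F _) FM.
suff sums m : exists x N, [/\ tail N x = 0, mass x <= m%:R &
    exists2 r, F x = of_ r & m%:R * (e / 2) <= r].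
  apply: (@no_sublinear_growth R p (e / 2) (normr_re F)) => // m.
  have [x [N [_ xm [r Fx er]]]] := sums m.
  apply: (le_trans er); apply: (le_trans (ler_norm r)).
  rewrite -(normr_re_of k) -Fx; apply: (le_trans (normr_re_op_le F x)).
  rewrite ler_wpM2l ?normr_re_ge0// massE ge0_ler_powR ?nnegrE ?mass_ge0//.
  by rewrite invr_ge0 ltW.
elim: m => [|m [x [N [x0 xm [r Fx er]]]]].
  exists 0, 0%N; split.
  - exact: ellpP => i /=.
  - by rewrite -powR_normr_re normr_re0 powR0// gt_eqF.
  - by exists 0; rewrite ?mul0r// linear0 scalar_of0.
have [z [M [z0 zM z1 [s Fz es]]]] := block N.
exists (x + z), (maxn N M); split.
- rewrite /tail restrictD -!/(tail _ _) (tail_eq0_le _ x0) ?leq_maxl//.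
  by rewrite (tail_eq0_le _ zM) ?leq_maxr// addr0.
- by rewrite (massD_disjoint x0 z0) -natr1 lerD// mass_le1.
- exists (r + s); first by rewrite linearD /= Fx Fz scalar_ofD.
  by rewrite -natr1 mulrDl mul1r lerD.
Qed.

Context (T : Type) (U : set_system T) {FU : Filter U} (w : T -> lp).
Hypothesis w_coord : forall i, normr_re (w t i : K^o) @[t --> U] --> (0 : R).

(** The tail of [F] is uniformly small on bounded sets, and finitely many
    coordinates tend to 0. *)
Lemma dual_cvg0 (F : dual_space lp) (C : R) :
  (forall t, normr_re (w t) <= C) -> normr_re (F (w t)) @[t --> U] --> (0 : R).
Proof.
move=> wC; apply/cvgrPdist_le => e e0.
have C1 : 0 < `|C| + 1 by rewrite ltr_wpDl.
have e'0 : 0 < e / 2 / (`|C| + 1) by rewrite !divr_gt0.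
have [N FN] := dual_small_on_tails F e'0.
have Fh : normr_re F * normr_re (cutoff N (w t)) @[t --> U] --> (0 : R).
  by rewrite -(mulr0 (normr_re F)); apply: cvgM (cutoff_cvg0 N w_coord); exact: cvg_cst.
have e20 : 0 < e / 2 by rewrite divr_gt0.
move/cvgrPdist_le/(_ _ e20) : Fh; apply: filterS => t.
rewrite !sub0r !normrN !ger0_norm ?mulr_ge0 ?normr_re_ge0// => Fh.
have Ft : normr_re (F (tail N (w t))) <= e / 2.
  apply: (le_trans (FN _ (cutoff_of_tail _ _))); rewrite mulrAC ler_pdivrMr//.
  rewrite ler_wpM2l ?(ltW e20)//; apply: (le_trans (normr_re_restrict_le _ _)).
  by rewrite (le_trans (wC t))// (le_trans (ler_norm _))// lerDl.
rewrite -(cutoff_tail N (w t)) linearD (splitr e).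
apply: (le_trans (normr_reD _ _)); apply: lerD => //.
exact: le_trans (normr_re_op_le F _) Fh.
Qed.

End WeakConvergence.

(** * Ultrafilter limits and compact operators *)

Lemma fmap_ultra (T S : Type) (f : T -> S) (U : set_system T) :
  UltraFilter U -> UltraFilter (f @ U).
Proof.
move=> UU; split; first exact: fmap_proper_filter.
move=> G GF UG; rewrite predeqE => A; split; last exact: UG.
move=> GA; have [//|UnA] := in_ultra_setVsetC (f @^-1` A) UU.
have /filter_ex[y []//] : G (A `&` ~` A).
by apply: filterI => //; apply: UG.
Qed.

Section NormConvergence.
Context (R : realType) (k : scalar_kind).
Local Notation K := (scalars R k).
Local Notation of_ := (@scalar_of R k).

Lemma scalar_gt0 (e : K) : 0 < e -> exists2 r : R, 0 < r & e = of_ r.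
Proof.
move=> e0; have e1 := ltW e0; exists (scalar_re e); last by rewrite scalar_reK.
rewrite lt_neqAle -(scalar_of_le k) (scalar_reK e1) scalar_of0 e1 andbT.
by apply: contraTneq e0 => e0; rewrite -(scalar_reK e1) -e0 scalar_of0 ltxx.
Qed.

Lemma scalar_of_lt (x y : R) : (of_ x < of_ y) = (x < y).
Proof. by rewrite !lt_neqAle scalar_of_le (inj_eq (can_inj (scalar_ofK k))). Qed.

Lemma cvg_normr_re (V : normedModType K) (T : Type) (U : set_system T)
    {FU : Filter U} (f : T -> V) (l : V) :
  f t @[t --> U] --> l <-> normr_re (f t - l) @[t --> U] --> (0 : R).
Proof.
split=> fl.
  apply/cvgrPdist_lt => e e0.
  have e0' : 0 < of_ e by rewrite -(scalar_of0 k) scalar_of_lt.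
  move/cvgrPdist_lt/(_ _ e0') : fl; apply: filterS => t.
  by rewrite sub0r normrN ger0_norm ?normr_re_ge0// distrC normr_reE scalar_of_lt.
apply/cvgrPdist_lt => _ /scalar_gt0[e e0 ->].
move/cvgrPdist_lt/(_ _ e0) : fl; apply: filterS => t.
by rewrite sub0r normrN ger0_norm ?normr_re_ge0// distrC normr_reE scalar_of_lt.
Qed.

End NormConvergence.

Lemma scalar_of_continuous (R : realType) (k : scalar_kind) :
  continuous (@scalar_of R k : R -> (scalars R k)^o).
Proof.
move=> x; apply/cvg_normr_re.
have -> : (fun t => normr_re ((scalar_of k t : (scalars R k)^o) - scalar_of k x)) =
    (fun t : R => `|t - x|).
  by apply/funext => t; rewrite -scalar_ofN -scalar_ofD normr_re_of.
apply/cvgrPdist_lt => e e0; apply: filterS (nbhsx_ballx x e e0) => t.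
by rewrite -ball_normE/= sub0r normrN normr_id distrC.
Qed.

Section Compactness.
Context (R : realType) (k : scalar_kind).
Local Notation K := (scalars R k).
Local Notation of_ := (@scalar_of R k).

(** In the complex case the disc is enclosed in a square, the continuous image of
    a product of two segments. *)
Lemma bounded_scalars_compact (C : R) : exists2 D : set K^o,
  compact D & forall a : K, normr_re (a : K^o) <= C -> D a.
Proof.
case: (k).
  exists (`[- C, C]%classic : set R); first exact: segment_compact.
  by move=> a aC; rewrite /= in_itv/= -ler_norml.
pose f (x : R^o * R^o) : (R[i])^o := (x.1%:C + 'i * x.2%:C)%C.
exists (f @` (`[- C, C]%classic `*` `[- C, C]%classic)).
  apply: continuous_compact; last by apply: compact_setX; exact: segment_compact.
  apply: continuous_subspaceT => x.
  have cof (y : R) : (t%:C)%C @[t --> y] --> ((y%:C)%C : (R[i])^o).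
    exact: (@scalar_of_continuous R ComplexScalars).
  apply: cvgD; first by apply: cvg_comp (cof x.1); exact: cvg_fst.
  apply: cvgM; first exact: cvg_cst.
  by apply: cvg_comp (cof x.2); exact: cvg_snd.
move=> a aC.
exists (complex.Re a, complex.Im a) => /=; last by rewrite /f -complexE.
rewrite normr_re_complex in aC.
split; rewrite /= in_itv/= -ler_norml; apply: le_trans aC;
  by rewrite -sqrtr_sqr ler_wsqrtr// ?lerDl ?lerDr sqr_ge0.
Qed.

Lemma bounded_ultra_cvg (T : Type) (U : set_system T) (UU : UltraFilter U)
    (f : T -> K) (C : R) : (forall t, normr_re (f t : K^o) <= C) ->
  exists l : K, f t @[t --> U] --> (l : K^o).
Proof.
move=> fC; have [D + CD] := bounded_scalars_compact C.
rewrite compact_ultra => /(_ (f @ U) (fmap_ultra f UU))[|l [_ fl]]; last by exists l.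
by apply: (@filterE T U) => t; exact/CD/fC.
Qed.

Lemma compact_op_subset (X Y : normedModType K) (T : bounded_op X Y) (D : set Y) :
  compact D -> (forall x, `|x| <= 1 -> D (T x)) -> compact_op X Y T.
Proof.
move=> cD TD; apply: (@subclosed_compact _ _ D) => //; first exact: closed_closure.
have /closure_id -> : closed D by apply: compact_closed => //; exact: norm_hausdorff.
by apply: closure_subset => _ [x /= x1 <-]; exact: TD.
Qed.

Lemma rank_one_op (X Y : normedModType K) (f : dual_space X) (y : Y) :
  exists2 S : bounded_op X Y, compact_op X Y S & forall x, S x = f x *: y.
Proof.
have [||S SE] := @linear_bounded_op R k X Y (fun x => f x *: y) (normr_re f * normr_re y).
- by move=> a u v; rewrite linearP scalerDl scalerA.
- by move=> x; rewrite (normr_reZ (f x)) mulrAC ler_wpM2r ?normr_re_ge0 ?normr_re_op_le.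
exists S => //.
have [D cD CD] := bounded_scalars_compact (normr_re f).
apply: (@compact_op_subset _ _ _ ((fun a : K^o => a *: y) @` D)).
  apply: continuous_compact => //; apply: continuous_subspaceT => a.
  exact: scalel_continuous.
move=> x; rewrite -(scalar_of1 k) -normr_re_leP => x1.
exists (f x); last by rewrite SE.
apply: CD; rewrite (le_trans (normr_re_op_le _ _))// ler_piMr ?normr_re_ge0//.
Qed.

End Compactness.

Section CompactNull.
Context (R : realType) (k : scalar_kind) (p : R) (p1 : 1 < p).
Local Notation K := (scalars R k).
Local Notation of_ := (@scalar_of R k).
Local Notation lp := (ellp k (ltW p1)).

(** Along the ultrafilter the images converge in norm by compactness; the limit
    is annihilated by every functional because the family is weakly null. *)
Lemma compact_op_cvg0 (Y : normedModType K) (A : bounded_op lp Y)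
    (T : Type) (U : set_system T) (UU : UltraFilter U) (w : T -> lp) (C : R) :
  compact_op lp Y A ->
  (forall i, normr_re (w t i : K^o) @[t --> U] --> (0 : R)) ->
  (forall t, normr_re (w t) <= C) -> normr_re (A (w t)) @[t --> U] --> (0 : R).
Proof.
move=> cA w0 wC.
pose c := `|C| + 1.
have c0 : 0 < c by rewrite ltr_wpDl.
pose w' t : lp := of_ c^-1 *: w t.
have w'1 t : `|w' t| <= 1.
  rewrite -(scalar_of1 k) -normr_re_leP normr_reZ normr_re_of ger0_norm ?invr_ge0 ?(ltW c0)//.
  rewrite mulrC ler_pdivrMr// mul1r (le_trans (wC t))// (le_trans (ler_norm _))//.
  by rewrite lerDl.
move: cA; rewrite /compact_op /= compact_ultra.
move=> /(_ ((A \o w') @ U) (fmap_ultra _ UU))[|y [_ Awy]].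
  by apply: (@filterE T U) => t; apply: subset_closure; exists (w' t); first exact: w'1.
have y0 : y = 0.
  apply: dual_separates => g.
  have [||gA gAE] := @linear_bounded_op R k lp K^o (g \o A) (normr_re g * normr_re A).
  - by move=> a u v; rewrite /= !linearP.
  - move=> x; rewrite (le_trans (normr_re_op_le g (A x)))// -mulrA.
    by rewrite ler_wpM2l ?normr_re_ge0 ?normr_re_op_le.
  have gAw : gA (w' t) @[t --> U] --> (g y : K^o).
    under eq_fun do rewrite gAE.
    by apply: (@cvg_comp _ _ _ (A \o w') g _ _ _ Awy); exact: bounded_op_continuous.
  have w'0 i : normr_re (w' t i : K^o) @[t --> U] --> (0 : R).
    have -> : (fun t => normr_re (w' t i : K^o)) =
        (fun t => c^-1 * normr_re (w t i : K^o)).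
      apply/funext => t; rewrite -[w' t i]/(of_ c^-1 *: (w t i : K^o)).
      by rewrite normr_reZ normr_re_of ger0_norm ?invr_ge0 ?(ltW c0).
    by rewrite -(mulr0 c^-1); apply: cvgM (w0 i); exact: cvg_cst.
  have gAw0 : gA (w' t) @[t --> U] --> (0 : K^o).
    apply/cvg_normr_re; under eq_fun do rewrite subr0.
    by apply: (@dual_cvg0 _ _ _ p1 _ _ _ _ w'0 gA 1) => t; rewrite normr_re_leP scalar_of1.
  exact: (cvg_unique (@norm_hausdorff _ K^o) gAw gAw0).
move/cvg_normr_re : Awy; rewrite y0 => Aw.
have -> : (fun t => normr_re (A (w t))) = (fun t => c * normr_re (A (w' t) - 0)).
  apply/funext => t; rewrite subr0 linearZ normr_reZ normr_re_of ger0_norm ?invr_ge0 ?(ltW c0)//.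
  by rewrite mulrA divff ?mul1r ?gt_eqF.
by rewrite -(mulr0 c); apply: cvgM => //; exact: cvg_cst.
Qed.

End CompactNull.

(** * Compact approximation from the M-ideal property *)

Lemma normr_fst_le (F : numDomainType) (U V : normedZmodType F) (x : U * V) :
  `|x.1| <= `|x|.
Proof. by rewrite prod_normE /Order.max; case: ifP => // /ltW. Qed.

Lemma normr_snd_le (F : numDomainType) (U V : normedZmodType F) (x : U * V) :
  `|x.2| <= `|x|.
Proof.
by rewrite prod_normE /Order.max; case: ifPn => // h; rewrite real_leNgt ?normr_real.
Qed.

Section MIdeal.
Context (R : realType) (k : scalar_kind) (X Y : normedModType (scalars R k)).
Local Notation K := (scalars R k).
Local Notation of_ := (@scalar_of R k).
Local Notation L := (bounded_op X Y).
Context (e : X) (f : dual_space X).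
Hypotheses (e1 : normr_re e <= 1) (f1 : normr_re f <= 1) (fe : f e = 1).

(** Replacing [A] by the operator [x |-> f x *: A e] of rank one leaves
    [phi A] unchanged and does not increase the norm. So [phi] has its full norm on compact
    operators, where it agrees with [phi - P phi], and the norm identity of the
    L-projection leaves nothing for [P phi]. *)
Lemma L_projection_eval_eq0 (P : {linear dual_space L -> dual_space L})
    (phi : dual_space L) :
  range P = annihilator (compact_op X Y) ->
  (forall g, `|g| = `|P g| + `|g - P g|) ->
  (forall A B : L, A e = B e -> phi A = phi B) -> P phi = 0.
Proof.
move=> Prange Pnorm phi_e.
apply: normr_re_eq0; apply/eqP; rewrite eq_le normr_re_ge0 andbT.
have nphi : normr_re phi = normr_re (P phi) + normr_re (phi - P phi).
  by apply: (can_inj (scalar_ofK k)); rewrite scalar_ofD -!normr_reE.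
suff : normr_re phi <= normr_re (phi - P phi) by rewrite nphi gerDr.
apply: normr_re_op_lub => [|A]; first exact: normr_re_ge0.
have [B cB BE] := rank_one_op f (A e).
have -> : phi A = (phi - P phi) B.
  have PB : P phi B = 0.
    have : annihilator (compact_op X Y) (P phi) by rewrite -Prange; exists phi.
    exact.
  rewrite -[RHS]/(phi B - P phi B) PB subr0; apply: phi_e.
  by rewrite BE fe scale1r.
apply: (le_trans (normr_re_op_le _ _)); rewrite ler_wpM2l ?normr_re_ge0//.
apply: normr_re_op_lub => [|x]; first exact: normr_re_ge0.
rewrite BE (normr_reZ (f x)) mulrC; apply: ler_pM; rewrite ?normr_re_ge0//.
  by rewrite (le_trans (normr_re_op_le _ _))// ler_piMr ?normr_re_ge0.
by rewrite (le_trans (normr_re_op_le _ _))// ler_piMl ?normr_re_ge0.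
Qed.

(** If no such [A] exists, then (S + T, t T e) has distance at least [c + d] from
    the pairs (A, t A e), [A] compact, in the max norm of the product; a
    separating functional contradicts the additivity of the norm under the
    L-projection. *)
Lemma M_ideal_approx (S T : L) (c d : R) :
  M_ideal (compact_op X Y) -> compact_op X Y S ->
  normr_re S <= c -> normr_re T <= c -> 0 < d ->
  exists2 A, compact_op X Y A &
    normr_re (S + T - A) <= c + d /\ normr_re (T e - A e) <= d.
Proof.
move=> [[C0 CZD _] [_ [P [PP Prange Pnorm]]]] cS Sc Tc d0.
have c0 : 0 <= c by exact: le_trans (normr_re_ge0 _) Sc.
have cd0 : 0 < c + d by rewrite ltr_wpDl.
apply: contrapT => noA.
(* With this weight, norm at most d of (T - A) e becomes norm at most c + d of
   the second component. *)
pose t := (c + d) / d.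
have t0 : 0 <= t by rewrite divr_ge0 ?ltW.
pose E : normedModType K := (L * Y)%type.
pose z : E := (S + T, of_ t *: T e).
pose M : set E := [set ((A, of_ t *: A e) : E) | A in compact_op X Y].
have [||m [A cA <-]|H [HM Hle Hz]] := @Hahn_Banach_separation R k E M z (c + d).
- exists 0 => //; congr pair.
  by rewrite -[(0 : L) e]/(0 : Y) scaler0.
- move=> a _ _ [A cA <-] [B cB <-]; exists (a *: A + B); first exact: CZD.
  congr pair; rewrite -[(a *: A + B) e]/(a *: A e + B e) scalerDr.
  by congr (_ + _); rewrite /= !scalerA mulrC.
- rewrite leNgt; apply/negP => zA; apply: noA; exists A => //.
  have zA' : `|z - (A, of_ t *: A e)| <= of_ (c + d) by rewrite -normr_re_leP ltW.
  have [zA1 zA2] : `|S + T - A| <= of_ (c + d) /\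
      `|of_ t *: T e - of_ t *: A e| <= of_ (c + d).
    by split; apply: le_trans zA'; [exact: (normr_fst_le (z - (A, of_ t *: A e)))
      |exact: (normr_snd_le (z - (A, of_ t *: A e)))].
  split; first by rewrite normr_re_leP.
  move: zA2; rewrite -normr_re_leP -scalerBr normr_reZ normr_re_of ger0_norm//.
  by rewrite /t mulrAC ler_pdivrMr// ler_pM2l.
have [||F FE] := @linear_bounded_op R k L K^o (fun A => H (A, 0)) 1.
- move=> a A B; rewrite -linearP; congr (H _); congr pair.
  by rewrite /= scaler0 addr0.
- move=> A; rewrite mul1r (le_trans (Hle _))// normr_re_leP -normr_reE.
  rewrite prod_normE/= normr0 /Order.max; case: ifP => // _; exact: normr_ge0.
have [||phi phiE] := @linear_bounded_op R k L K^o (fun A => H (0, of_ t *: A e)) t.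
- move=> a A B; rewrite -linearP; congr (H _); congr pair.
    by rewrite /= scaler0 addr0.
  rewrite -[(a *: A + B) e]/(a *: A e + B e) scalerDr.
  by congr (_ + _); rewrite /= !scalerA mulrC.
- move=> A; rewrite (le_trans (Hle _))//.
  apply: (@le_trans _ _ (normr_re (of_ t *: A e))).
    rewrite normr_re_leP -normr_reE prod_normE/= normr0 /Order.max.
    by case: ifP.
  rewrite normr_reZ normr_re_of ger0_norm// ler_wpM2l//.
  by rewrite (le_trans (normr_re_op_le _ _))// ler_piMr ?normr_re_ge0.
(* G is the functional A |-> H (A, t A e), so it vanishes on compact operators. *)
pose G : dual_space L := F + phi.
have GE A : G A = H (A, of_ t *: A e).
  rewrite -[G A]/(F A + phi A) FE phiE -linearD; congr (H _).
  by congr pair; rewrite /= ?addr0 ?add0r.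
have PG : P G = G.
  have : annihilator (compact_op X Y) G by move=> A cA; rewrite GE HM//; exists A.
  by rewrite -Prange => -[g _ <-]; rewrite PP.
have Pphi : P phi = 0.
  apply: (L_projection_eval_eq0 Prange Pnorm) => A B AB.
  by rewrite !phiE AB.
have PF : P F = G by rewrite -PG /G linearD Pphi addr0.
have nF : normr_re F = normr_re G + normr_re phi.
  apply: (can_inj (scalar_ofK k)); rewrite scalar_ofD -!normr_reE Pnorm PF.
  by rewrite /G opprD addNKr normrN.
have F1 : normr_re F <= 1.
  apply: normr_re_op_lub => // A; rewrite FE mul1r (le_trans (Hle _))//.
  rewrite normr_re_leP -normr_reE prod_normE/= normr0 /Order.max.
  by case: ifP => // _; exact: normr_ge0.
move: Hz; rewrite leNgt => /negP; apply.
have -> : H z = G T - phi S.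
  have GS : G S = 0 by rewrite GE HM//; exists S.
  have : G S = F S + phi S by [].
  rewrite GS => /esym/eqP; rewrite addr_eq0 => /eqP <-.
  rewrite GE FE -linearD; congr (H _); congr pair => /=.
    by rewrite addrC.
  by rewrite addr0.
apply: (@le_lt_trans _ _ c); last by rewrite ltrDl.
apply: (le_trans (normr_reB _ _)).
apply: (@le_trans _ _ (normr_re F * c)); last by rewrite ler_piMl.
rewrite nF mulrDl; apply: lerD; apply: (le_trans (normr_re_op_le _ _)).
  by rewrite ler_wpM2l ?normr_re_ge0.
by rewrite ler_wpM2l ?normr_re_ge0.
Qed.

End MIdeal.

(** * Norm splitting at coordinatewise limits *)

Lemma ler_cvg (R : realType) (T : Type) (U : set_system T) {PU : ProperFilter U}
    (f g : T -> R) (l m : R) : (forall t, f t <= g t) ->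
  f t @[t --> U] --> l -> g t @[t --> U] --> m -> l <= m.
Proof.
move=> fg fl gm; rewrite -subr_ge0; apply: (cvgr_to_ge (cvgB gm fl)).
by apply: nearW => t /=; rewrite subr_ge0.
Qed.

Section WeakLimits.
Context (R : realType) (k : scalar_kind).
Local Notation K := (scalars R k).
Local Notation of_ := (@scalar_of R k).

Lemma cvg_normr_re_norm (V : normedModType K) (T : Type) (U : set_system T)
    {FU : Filter U} (f : T -> V) (l : V) :
  normr_re (f t - l) @[t --> U] --> (0 : R) ->
  normr_re (f t) @[t --> U] --> normr_re l.
Proof.
move=> fl; apply/cvgrPdist_lt => e e0.
move/cvgrPdist_lt/(_ _ e0) : fl; apply: filterS => t.
rewrite sub0r normrN ger0_norm ?normr_re_ge0//; apply: le_lt_trans.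
rewrite ler_norml lerNl opprB !lerBlDr; apply/andP; split.
  by rewrite -{1}(subrK l (f t)) normr_reD.
by rewrite -{1}(subrK (f t) l) -opprB (le_trans (normr_reD _ _))// normr_reN.
Qed.

Context (p : R) (p1 : 1 <= p).
Local Notation lp := (ellp k p1).
Context (T : Type) (U : set_system T).

Let p0 : 0 < p. Proof. exact: lt_le_trans p1. Qed.

Lemma mass_cutoff_cvg {FU : Filter U} (u : T -> lp) (v : nat -> K) (N : nat) :
  (forall i, normr_re ((u t i : K^o) - v i) @[t --> U] --> (0 : R)) ->
  mass (cutoff N (u t)) @[t --> U] --> \sum_(i < N) normr_re (v i : K^o) `^ p.
Proof.
move=> uv.
have -> : (fun t => mass (cutoff N (u t))) =
    (fun t => \sum_(i < N) normr_re (u t i : K^o) `^ p).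
  by apply/funext => t; rewrite mass_cutoff.
elim: N => [|N ih].
  by under eq_fun do rewrite big_ord0; rewrite big_ord0; exact: cvg_cst.
under eq_fun do rewrite big_ord_recr; rewrite big_ord_recr; apply: cvgD => //.
apply: (cvg_powR p0 (fun t => normr_re_ge0 _) (normr_re_ge0 _)).
exact: cvg_normr_re_norm.
Qed.

Lemma coordinatewise_limit (UU : UltraFilter U) (u : T -> lp) :
  (forall t, normr_re (u t) <= 1) ->
  exists v : lp, forall i, normr_re ((u t - v) i : K^o) @[t --> U] --> (0 : R).
Proof.
move=> u1.
have /choice[v uv] : forall i, exists l : K,
    normr_re ((u t i : K^o) - l) @[t --> U] --> (0 : R).
  move=> i; have [|l ul] := @bounded_ultra_cvg _ _ _ _ UU (fun t => u t i) 1.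
    by move=> t; rewrite (le_trans (normr_re_coord_le _ _)).
  by exists l; exact/(cvg_normr_re (V := K^o)).
have vP : v \in @ellp_pred R k p.
  apply: (@ellp_pred_bounded R k p v 1) => N.
  apply: (cvgr_to_le (mass_cutoff_cvg (N := N) uv)); apply: nearW => t.
  by rewrite mass_le1// (le_trans (normr_re_restrict_le _ _)).
by exists (Ellp p1 vP).
Qed.

(** Cut at [N]: the head of [u t - v] tends to 0, and its tail is at most
    the tail of [u t], whose mass is at most [1 - mass (cutoff N (u t))], plus
    the tail of [v]. First pass to the limit along [U], then in [N]. *)
Lemma mass_weak_limit_le {PU : ProperFilter U} (u : T -> lp) (v : lp) (b : R) :
  (forall t, normr_re (u t) <= 1) ->
  (forall i, normr_re ((u t - v) i : K^o) @[t --> U] --> (0 : R)) ->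
  normr_re (u t - v) @[t --> U] --> b -> b `^ p + mass v <= 1.
Proof.
move=> u1 w0 wb.
have b0 : 0 <= b by apply: (cvgr_to_ge wb); apply: nearW => t; exact: normr_re_ge0.
have cut_le N t : mass (cutoff N (u t)) <= 1.
  by rewrite mass_le1// (le_trans (normr_re_restrict_le _ _)).
have uv i : normr_re ((u t i : K^o) - v i) @[t --> U] --> (0 : R) by exact: w0.
have mN N : mass (cutoff N (u t)) @[t --> U] --> mass (cutoff N v).
  by rewrite mass_cutoff; exact: mass_cutoff_cvg.
have mN1 N : mass (cutoff N v) <= 1.
  by apply: (cvgr_to_le (mN N)); apply: nearW => t.
have ip0 : 0 < p^-1 by rewrite invr_gt0.
have b_le N : b <= (1 - mass (cutoff N v)) `^ p^-1 + normr_re (tail N v).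
  have gl : normr_re (cutoff N (u t - v)) + (1 - mass (cutoff N (u t))) `^ p^-1 +
      normr_re (tail N v) @[t --> U] -->
      0 + (1 - mass (cutoff N v)) `^ p^-1 + normr_re (tail N v).
    apply: cvgD; last exact: cvg_cst.
    apply: cvgD; first exact: cutoff_cvg0.
    apply: cvg_powR => [//|t||]; rewrite ?subr_ge0//.
    by apply: cvgB (mN N); exact: cvg_cst.
  rewrite add0r in gl; apply: (ler_cvg _ wb gl) => t.
  rewrite -{1}(cutoff_tail N (u t - v)) -addrA; apply: (le_trans (normr_reD _ _)).
  rewrite lerD2l /tail restrictB -!/(tail _ _); apply: (le_trans (normr_reB _ _)).
  rewrite lerD2r massE ge0_ler_powR ?nnegrE ?mass_ge0 ?subr_ge0// ?(ltW ip0)//.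
  by rewrite lerBrDl -mass_cutoff_tail mass_le1.
have mv : mass (cutoff N v) @[N --> \oo] --> mass v.
  have := cvg_powR p0 (fun N => normr_re_ge0 (tail N v)) (lexx 0) (@tail_cvg0 _ _ _ _ v).
  rewrite powR0 ?gt_eqF// => /(_ _) tl.
  have -> : (fun N => mass (cutoff N v)) =
      (fun N => mass v - normr_re (tail N v) `^ p).
    by apply/funext => N; rewrite powR_normr_re (mass_cutoff_tail N v) addrK.
  by have := cvgB (cvg_cst (mass v)) tl; rewrite subr0; apply.
have bv : b <= (1 - mass v) `^ p^-1.
  have gl : (1 - mass (cutoff N v)) `^ p^-1 + normr_re (tail N v) @[N --> \oo] -->
      (1 - mass v) `^ p^-1.
    rewrite -[X in _ --> X]addr0; apply: cvgD; last exact: tail_cvg0.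
    apply: cvg_powR => [//|t||]; rewrite ?subr_ge0//.
      by apply: (cvgr_to_le mv); apply: nearW => N.
    by apply: cvgB mv; exact: cvg_cst.
  exact: (@ler_cvg R nat \oo _ (fun=> b) _ b _ b_le (cvg_cst b) gl).
have v1 : 0 <= 1 - mass v by rewrite subr_ge0; apply: (cvgr_to_le mv); apply: nearW => N.
rewrite -lerBrDr -(powRVK (gt_eqF p0) v1).
by apply: ge0_ler_powR; rewrite ?nnegrE ?powR_ge0 ?(ltW p0).
Qed.

(** Only the first coordinates of the two vectors overlap. *)
Lemma normr_re_unit0D (t : R) (w : lp) : 0 <= t ->
  normr_re (of_ t *: unit0 k p1 + w) <=
  (t `^ p + mass w) `^ p^-1 + normr_re (cutoff 1 w).
Proof.
move=> t0; rewrite -{1}(cutoff_tail 1 w) addrCA addrC.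
apply: (le_trans (normr_reD _ _)); rewrite lerD2r massE.
have tE : tail 1 (of_ t *: unit0 k p1) = 0.
  by rewrite /tail restrictZ -/(tail _ _) tail1_unit0 scaler0.
have mt : mass (of_ t *: unit0 k p1) = t `^ p.
  by rewrite -powR_normr_re normr_reZ normr_re_unit0 mulr1 normr_re_of ger0_norm.
rewrite (massD_disjoint tE (cutoff_of_tail 1 w)) mt.
apply: ge0_ler_powR; rewrite ?nnegrE ?invr_ge0 ?(ltW p0) ?addr_ge0 ?powR_ge0 ?mass_ge0//.
by rewrite lerD2l -ler_mass normr_re_restrict_le.
Qed.

End WeakLimits.

(** * Maximizing sequences *)

Section MaximizingSequences.
Context (R : realType) (k : scalar_kind).
Local Notation K := (scalars R k).
Local Notation of_ := (@scalar_of R k).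

Lemma first_coordinate (p : R) (p1 : 1 <= p) : exists f : dual_space (ellp k p1),
  normr_re f <= 1 /\ f (unit0 k p1) = 1.
Proof.
have [||f fE] := @linear_bounded_op R k (ellp k p1) K^o (fun x => x 0%N) 1.
- by [].
- by move=> x; rewrite mul1r normr_re_coord_le.
exists f; split; last by rewrite fE.
by apply: normr_re_op_lub => // x; rewrite fE mul1r normr_re_coord_le.
Qed.

(** The quantitative form of the corollary: at the coordinatewise limit [v] of a
    maximizing family, [T] loses nothing of its norm. *)
Lemma M_ideal_weak_limit (p : R) (p1 : 1 < p) (Y : normedModType K)
    (A : Type) (U : set_system A) (UU : UltraFilter U)
    (T : bounded_op (ellp k (ltW p1)) Y) (u : A -> ellp k (ltW p1))
    (v : ellp k (ltW p1)) :
  M_ideal (compact_op (ellp k (ltW p1)) Y) -> 0 < normr_re T ->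
  (forall a, normr_re (u a) <= 1) ->
  normr_re (T (u a)) @[a --> U] --> normr_re T ->
  (forall i, normr_re ((u a - v) i : K^o) @[a --> U] --> (0 : R)) ->
  normr_re T * normr_re v <= normr_re (T v).
Proof.
set lp := ellp k (ltW p1); set c := normr_re T => KL c0 u1 Tu w0.
have p0 : 0 < p by exact: (lt_trans _ p1).
pose w a : lp := u a - v; pose e : lp := unit0 k (ltW p1).
have w2 a : normr_re (w a) <= 1 + normr_re v.
  by rewrite (le_trans (normr_reB _ _))// lerD2r.
have [b wb] : exists b : R, normr_re (w a) @[a --> U] --> b.
  apply: (@bounded_ultra_cvg R RealScalars _ _ UU (fun a => normr_re (w a)) (1 + normr_re v)).
  by move=> a; apply: le_trans (w2 a); rewrite -[leLHS]/(`|normr_re (w a)|) ger0_norm ?normr_re_ge0.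
have b0 : 0 <= b by apply: (cvgr_to_ge wb); apply: nearW => a; exact: normr_re_ge0.
have bv : b `^ p + mass v <= 1 by exact: (mass_weak_limit_le u1 w0 wb).
pose t := normr_re (T v) / c.
have t0 : 0 <= t by rewrite divr_ge0 ?normr_re_ge0 ?ltW.
pose s := (t `^ p + b `^ p) `^ p^-1.
have s0 : 0 <= s by exact: powR_ge0.
have [f [f1 fe]] := first_coordinate (ltW p1).
(* If t = 0, then T v = 0 and the convention 0^-1 = 0 gives S = 0. *)
pose y : Y := of_ t^-1 *: T v.
have Tvc : normr_re (T v) = t * c by rewrite divfK ?gt_eqF.
have yc : normr_re y <= c.
  rewrite normr_reZ normr_re_of ger0_norm ?invr_ge0// Tvc mulrA.
  have [->|tN0] := eqVneq t 0; first by rewrite mulr0 mul0r ltW.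
  by rewrite mulVf// mul1r.
have [S cS SE] := rank_one_op f y.
have Sc : normr_re S <= c.
  apply: normr_re_op_lub => [|x]; first exact: ltW.
  rewrite SE (normr_reZ (f x)) mulrC ler_pM ?normr_re_ge0//.
  by rewrite (le_trans (normr_re_op_le f x))// ler_piMl ?normr_re_ge0.
have Se : of_ t *: S e = T v.
  rewrite SE fe scale1r /y scalerA -scalar_ofM.
  have [tE|tN0] := eqVneq t 0; last by rewrite divff// scalar_of1 scale1r.
  have /normr_re_eq0 -> : normr_re (T v) = 0 by rewrite Tvc tE mul0r.
  by rewrite scaler0.
have main d : 0 < d -> c <= (c + d) * s + t * d.
  move=> d0.
  have e1 : normr_re e <= 1 by rewrite normr_re_unit0.
  have [B cB [SB eB]] := M_ideal_approx e1 f1 fe KL cS Sc (lexx c) d0.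
  have cvgS := compact_op_cvg0 UU cS w0 w2.
  have cvgB' := compact_op_cvg0 UU cB w0 w2.
  have cvg1 := cutoff_cvg0 1 w0.
  pose g a := (c + d) * ((t `^ p + mass (w a)) `^ p^-1 + normr_re (cutoff 1 (w a))) +
    (normr_re (S (w a)) + t * d + normr_re (B (w a))).
  have gl : g a @[a --> U] --> (c + d) * (s + 0) + (0 + t * d + 0).
    apply: cvgD; last first.
      by apply: cvgD; [apply: cvgD; [exact: cvgS|exact: cvg_cst]|exact: cvgB'].
    apply: cvgM; first exact: cvg_cst.
    apply: cvgD; last exact: cvg1.
    rewrite /s; apply: cvg_powR => [|a||].
    - by rewrite invr_gt0.
    - by rewrite addr_ge0 ?powR_ge0 ?mass_ge0.
    - by rewrite addr_ge0 ?powR_ge0.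
    - apply: cvgD; first exact: cvg_cst.
      have -> : (fun a => mass (w a)) = (fun a => normr_re (w a) `^ p).
        by apply/funext => a; rewrite powR_normr_re.
      by apply: cvg_powR => // a; exact: normr_re_ge0.
  rewrite !addr0 add0r in gl; apply: (ler_cvg _ Tu gl) => a.
  pose x := of_ t *: e + w a.
  have -> : T (u a) = (S + T - B) x - (S (w a) + of_ t *: (T e - B e) - B (w a)).
    have xE (A' : bounded_op lp Y) : A' x = of_ t *: A' e + A' (w a).
      exact: linearP.
    have -> : T (u a) = T v + T (w a) by rewrite -linearD /w addrC subrK.
    apply/esym/eqP; rewrite subr_eq -[(S + T - B) x]/(S x + T x - B x) !xE Se scalerBr.
    rewrite (addrC (of_ t *: T e) (T (w a))) addrACA; apply/eqP.
    by rewrite -[LHS]addrA; congr (_ + _ + _); rewrite opprD !addrA.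
  apply: (le_trans (normr_reB _ _)); apply: lerD.
    apply: (le_trans (normr_re_op_le _ _)).
    apply: ler_pM; rewrite ?normr_re_ge0//; exact: normr_re_unit0D.
  apply: (le_trans (normr_reB _ _)); rewrite lerD2r.
  apply: (le_trans (normr_reD _ _)); rewrite lerD2l normr_reZ normr_re_of.
  by rewrite ger0_norm// ler_wpM2l.
have s1 : 1 <= s.
  rewrite -(ler_pM2l c0) mulr1; apply/ler_addgt0Pr => d d0.
  have st0 : 0 < s + t + 1 by rewrite ltr_wpDl ?addr_ge0.
  apply: (le_trans (main (d / (s + t + 1)) (divr_gt0 d0 st0))).
  rewrite mulrDl -addrA lerD2l (mulrC t) -mulrDr mulrAC ler_pdivrMr//.
  by rewrite ler_pM2l// lerDl.
have vt : normr_re v <= t.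
  rewrite -(ler_powR2r p0) ?normr_re_ge0// powR_normr_re.
  have : 1 <= t `^ p + b `^ p.
    rewrite -(powRVK (gt_eqF p0) (addr_ge0 (powR_ge0 t p) (powR_ge0 b p))) -/s.
    by rewrite (le_trans s1)// le1r_powR// ltW.
  by move: bv; rewrite -lerBrDl => /le_trans bv; rewrite -lerBlDr => /bv.
by rewrite mulrC -ler_pdivlMr.
Qed.

End MaximizingSequences.

Theorem corollary3p6 (R : realType) (k : scalar_kind) (p : R) (p1 : 1 < p)
    (Y : completeNormedModType (scalars R k)) :
  M_ideal (compact_op (ellp k (ltW p1)) Y) -> WMP (ellp k (ltW p1)) Y.
Proof.
move=> KL T [u [u1 Tu] /existsNP[f fu]].
pose e := unit0 k (ltW p1).
have ne (V : normedModType (scalars R k)) (x : V) : normr_re x = 1 -> `|x| = 1.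
  by rewrite normr_reE => ->; rewrite scalar_of1.
have [T0|T0] := eqVneq (normr_re T) 0.
  exists e; first by apply: ne; exact: normr_re_unit0.
  have := normr_re_op_le T e; rewrite T0 mul0r => Te.
  by rewrite !normr_reE T0; congr scalar_of; apply/eqP; rewrite eq_le Te normr_re_ge0.
have {}T0 : 0 < normr_re T by rewrite lt_neqAle eq_sym T0 normr_re_ge0.
have u1' n : normr_re (u n) <= 1 by rewrite normr_re_leP scalar_of1.
have Tu' : normr_re (T (u n)) @[n --> \oo] --> normr_re T.
  move/cvg_normr_re : Tu => Tu; apply/cvgrPdist_lt => d d0.
  move/cvgrPdist_lt/(_ _ d0) : Tu; apply: filterS => n.
  rewrite sub0r normrN ger0_norm ?normr_re_ge0// !normr_reE -scalar_ofN.
  by rewrite -scalar_ofD normr_re_of distrC.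
have [d d0 fd] : exists2 d : R, 0 < d &
    ~ \forall n \near \oo, normr_re (f (u n)) < d.
  apply: contrapT => nod; apply: fu; apply/cvg_normr_re/cvgrPdist_lt => d d0.
  apply: contrapT => nd; apply: nod; exists d => // fd; apply: nd.
  by apply: filterS fd => n; rewrite subr0 sub0r normrN ger0_norm ?normr_re_ge0.
(* D is the subsequence on which f stays away from 0; the ultrafilter refines it. *)
pose D := [set n | d <= normr_re (f (u n))].
have FD : ProperFilter (within D \oo).
  split; last exact: within_filter.
  rewrite /within /= => h; apply: fd; apply: filterS h => n /= h.
  by rewrite ltNge; apply/negP.
have [U [UU sU]] := ultraFilterLemma FD.
have ooU : \oo `<=` U by move=> P ooP; apply: sU; apply: filterS ooP => n Pn _.
have UD : U D by apply: sU; apply: (@filterE _ \oo).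
have [v w0] := coordinatewise_limit UU u1'.
have fw : normr_re (f (u n - v)) @[n --> U] --> (0 : R).
  apply: (dual_cvg0 w0 f (C := 1 + normr_re v)) => n.
  by rewrite (le_trans (normr_reB _ _))// lerD2r.
(* If v = 0, then u n itself is coordinatewise null and f (u n) tends to 0. *)
have v0 : 0 < normr_re v.
  rewrite lt_neqAle normr_re_ge0 andbT eq_sym; apply/negP => /eqP/normr_re_eq0 v0.
  move/cvgrPdist_lt/(_ _ d0) : fw => fw.
  have [n []] := filter_ex (filterI fw UD).
  by rewrite /= v0 subr0 sub0r normrN ger0_norm ?normr_re_ge0// ltNge => /negP.
have Tv : normr_re T * normr_re v <= normr_re (T v).
  apply: (M_ideal_weak_limit UU KL T0 u1' _ w0).
  by move=> P /Tu'; exact: ooU.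
pose x := scalar_of k (normr_re v)^-1 *: v.
have nx : normr_re x = 1.
  by rewrite normr_reZ normr_re_of ger0_norm ?invr_ge0 ?ltW// mulVf ?gt_eqF.
exists x; first exact: ne.
rewrite !normr_reE; congr scalar_of; apply/eqP; rewrite eq_le.
have := normr_re_op_le T x; rewrite nx mulr1 => -> /=.
rewrite linearZ normr_reZ normr_re_of ger0_norm ?invr_ge0 ?(ltW v0)//.
by rewrite ler_pdivlMl// mulrC.
Qed.
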